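(* Assume $m_2>m_3=0$. For each $n\in\mathbb{Z}^+$ let $\mathcal{K}_n$ be the set defined in the context, regarded as a set of points $(m_1,m_2,\alpha)\in\mathbb{R}^3$. Then $(\mathcal{K}_n)_{n\in\mathbb{Z}^+}$ is a family of semi-analytic subsets of $\mathbb{R}^3$ such that: (a) Every point $(m_1,m_2,\alpha)\in\mathcal{K}_n$ corresponds, via the explicit parameterization given in the context, to three complex reflections $R_1,R_2,R_3\in\mathrm{PU}(2,1)$ such that $\iota_j\mapsto R_j$ is a complex hyperbolic $[m_1,m_2,0]$-triangle group representation with angular invariant $\alpha$. (b) Each set $\mathcal{K}_n$ is defined (inside the parameter domain $Y>0$, $\alpha\in[0,\pi]$) by the three inequalities $X\ge\frac2n$, $X\le\frac{2}{n-1}$ (omitted when $n=1$) and $$-n^2(X^2+Y^2)+n\big(X^2-Y^2+4(Y+1)X\big)-2X-4Y-4\ge0,$$ which are inequalities in the quantities $r_j=\cosh(m_j/2)$, $s_j=\sinh(m_j/2)$. (c) The representation corresponding to a point of $\mathcal{K}_n$ is discrete and faithful if and only if the element $R_1(R_2R_1)^nR_3$ is non-elliptic.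
   Context: **Siegel model.** $\mathbb{C}^3$ carries the Hermitian form $\langle z,w\rangle=z_1\overline w_3+z_2\overline w_2+z_3\overline w_1$; $\mathbf{H}^2_{\mathbb C}$ and $\partial\mathbf{H}^2_{\mathbb C}$ are the projectivizations of the negative vectors and of the nonzero null vectors, with metric $\cosh^2(\rho(z,w)/2)=\frac{\langle z,w\rangle\langle w,z\rangle}{\langle z,z\rangle\langle w,w\rangle}$. $\mathrm{PU}(2,1)$ is the holomorphic isometry group; an element is parabolic if it has exactly one fixed point on $\partial\mathbf{H}^2_{\mathbb C}$, loxodromic if exactly two, elliptic otherwise. A complex geodesic with polar vector $n$ ($\langle n,n\rangle>0$; normalized if $\langle n,n\rangle=1$) is the projectivization of $n^\perp$ intersected with $\mathbf{H}^2_{\mathbb C}$; the complex reflection in it is $R(z)=-z+2\frac{\langle z,n\rangle}{\langle n,n\rangle}n$. **Triangle groups.** Let $R_1,R_2,R_3$ be complex reflections whose mirrors $C_1,C_2,C_3$ are distinct and pairwise ultra-parallel (no common point in $\mathbf{H}^2_{\mathbb C}\cup\partial\mathbf{H}^2_{\mathbb C}$) or asymptotic (meeting only on $\partial\mathbf{H}^2_{\mathbb C}$). With $m_j=\rho(C_{j-1},C_{j+1})$ (indices mod 3), $m_1\ge m_2\ge m_3\ge0$, the group $\langle R_1,R_2,R_3\rangle$ is a complex hyperbolic ultra-parallel $[m_1,m_2,m_3]$-triangle group. For normalized polar vectors, $\cosh(m_j/2)=|\langle n_{j-1},n_{j+1}\rangle|$. Let $\Gamma=\langle\iota_1,\iota_2,\iota_3\mid\iota_j^2=1\rangle$.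 A complex hyperbolic $[m_1,m_2,m_3]$-triangle group representation is a homomorphism $\Gamma\to\mathrm{PU}(2,1)$, $\iota_j\mapsto R_j$, where $R_1,R_2,R_3$ are complex reflections whose mirrors $C_1,C_2,C_3$ are distinct and pairwise ultra-parallel or asymptotic, with $\rho(C_{j-1},C_{j+1})=m_j$ for $j=1,2,3$ (indices mod 3) and $m_1\ge m_2\ge m_3\ge0$; it is discrete if its image is discrete, faithful if injective. The angular invariant is $\alpha=\arg(\langle n_1,n_3\rangle\langle n_2,n_1\rangle\langle n_3,n_2\rangle)$, restricted to $[0,\pi]$. **Parameterization for $m_3=0$.** Put $r_j=\cosh(m_j/2)$ and $\theta=\frac{\pi-\alpha}{2}\in[0,\frac\pi2]$. The normalized polar vectors of the mirrors of $R_1,R_2,R_3$ are $$n_1=(\sqrt2\,r_2e^{-i\theta},1,0)^T,\quad n_2=(-\sqrt2\,r_1e^{i\theta},1,0)^T,\quad n_3=(1/\sqrt2,0,1/\sqrt2)^T .$$ **The sets.** For $r_2>1$ put $(X,Y)=\left(\frac{r_1^2-1}{r_2^2-1}-1,\ \frac1{r_2^2-1}\right)$, equivalently $r_1=\sqrt{1+\frac{X+1}{Y}}$, $r_2=\sqrt{1+\frac1Y}$. The set $\mathcal{K}_n$ consists of the points whose $(X,Y,\alpha)$ satisfies $Y>0$, $\alpha\in[0,\pi]$, $\frac2n\le X\le\frac2{n-1}$ (the upper bound being omitted when $n=1$) and $$-n^2(X^2+Y^2)+n\big(X^2-Y^2+4(Y+1)X\big)-2X-4Y-4\ge0 .$$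 *)

(* Defs.v *)
From HB Require Import structures.
From mathcomp Require Import all_boot all_order all_algebra.
From mathcomp Require Import all_classical all_reals all_analysis.
From mathcomp Require Import complex ring.

Set Implicit Arguments.
Unset Strict Implicit.
Unset Printing Implicit Defensive.

Import Order.TTheory GRing.Theory Num.Theory.
Import numFieldNormedType.Exports.
Local Open Scope classical_set_scope.
Local Open Scope ring_scope.

Definition cosh (R : realType) (t : R) : R := (expR t + expR (- t)) / 2.
Definition sinh (R : realType) (t : R) : R := (expR t - expR (- t)) / 2.
Definition arcosh (R : realType) (x : R) : R := ln (x + Num.sqrt (x ^+ 2 - 1)).

Lemma cosh_arcosh (R : realType) (x : R) : 1 <= x -> cosh (arcosh x) = x.
Proof.
move=> x1; have x0 : 0 < x by apply: lt_le_trans x1.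
set s := Num.sqrt (x ^+ 2 - 1).
have s0 : 0 <= s by exact: sqrtr_ge0.
have ss : s ^+ 2 = x ^+ 2 - 1 by rewrite sqr_sqrtr// subr_ge0 exprn_ege1.
have e0 : 0 < x + s by rewrite ltr_pwDl.
rewrite /cosh /arcosh -/s expRN lnK ?posrE//.
have -> : (x + s)^-1 = x - s.
  apply: (mulfI (lt0r_neq0 e0)).
  by rewrite mulfV ?lt0r_neq0// mulrC -subr_sqr ss opprB addrC subrK.
by rewrite addrACA subrr addr0 -mulr2n -[x *+ 2]mulr_natr mulfK// pnatr_eq0.
Qed.

(* The argument with values in ]-pi, pi] (and carg 0 = pi / 2). *)
Definition carg (R : realType) (z : R[i]) : R :=
  let t := acos (complex.Re z / complex.Re `|z|) in
  if 0 <= complex.Im z then t else - t.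

Definition expi (R : realType) (t : R) : R[i] := (cos t +i* sin t)%C.

(* The usual topology of the complex plane, given by the modulus. *)
HB.instance Definition _ (R : realType) :=
  PseudoPointedMetric.copy R[i] (R[i])^o.

(* The indices 1, 2, 3 of the coordinates and of the triangle are 0, 1, 2 : 'I_3. *)

Notation C3 R := 'cV[R[i]]_3.

Definition herm (R : realType) (z w : C3 R) : R[i] :=
  z 0 0 * (w 2%:R 0)^* + z 1 0 * (w 1 0)^* + z 2%:R 0 * (w 0 0)^*.

(* A point of the complex projective plane is a line <[z]> of C^3. *)
Definition H2C (R : realType) : set {vspace C3 R} :=
  [set p | exists2 z, herm z z < 0 & p = <[z]>%VS].

Definition bdH2C (R : realType) : set {vspace C3 R} :=
  [set p | exists z, [/\ z != 0, herm z z = 0 & p = <[z]>%VS]].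

Arguments H2C R : clear implicits.
Arguments bdH2C R : clear implicits.

(* The ratio does not depend on the chosen representatives of p and q. *)
Definition hdist (R : realType) (p q : {vspace C3 R}) : R :=
  let z := vpick p in let w := vpick q in
  2 * arcosh (Num.sqrt
    (complex.Re (herm z w * herm w z / (herm z z * herm w w)))).

Definition is_U21 (R : realType) (A : 'M[R[i]]_3) : bool :=
  `[< forall z w : C3 R, herm (A *m z) (A *m w) = herm z w >].

Record U21 (R : realType) := MkU21 {
  U21val :> 'M[R[i]]_3;
  U21P : is_U21 U21val }.

HB.instance Definition _ (R : realType) := [isSub for @U21val R].
HB.instance Definition _ (R : realType) := [Choice of U21 R by <:].
HB.instance Definition _ (R : realType) :=
  Topological.copy (U21 R) (initial_topology (@U21val R)).

Section U21Group.
Variable R : realType.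
Implicit Types (A B : 'M[R[i]]_3) (z w n : C3 R).

Lemma hermDl z1 z2 w : herm (z1 + z2) w = herm z1 w + herm z2 w.
Proof.
by rewrite /herm !mxE; ring.
Qed.

Lemma hermZl a z w : herm (a *: z) w = a * herm z w.
Proof. by rewrite /herm !mxE -!mulrA -!mulrDr. Qed.

Lemma herm_conj z w : (herm z w)^* = herm w z.
Proof.
by rewrite /herm !rmorphD !rmorphM /= !conjCK; ring.
Qed.

Lemma hermDr z w1 w2 : herm z (w1 + w2) = herm z w1 + herm z w2.
Proof. by rewrite -herm_conj hermDl rmorphD /= !herm_conj. Qed.

Lemma hermZr a z w : herm z (a *: w) = a^* * herm z w.
Proof. by rewrite -herm_conj hermZl rmorphM /= herm_conj. Qed.

Lemma herm_nondeg z : (forall w, herm z w = 0) -> z = 0.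
Proof.
move=> z0; apply/matrixP => i j; rewrite ord1 mxE.
have := z0 (delta_mx (- i - 1) 0); rewrite /herm !mxE !eqxx !andbT.
case: i => [[|[|[|//]]] hi] /=; rewrite ?conjC0 ?conjC1 ?mulr0 ?mulr1 ?addr0
  ?add0r => <-; congr (z _ _); exact: val_inj.
Qed.

Lemma is_U21_unit A : is_U21 A -> A \in unitmx.
Proof.
move=> /asboolP uA; rewrite unitmxE unitfE -det_tr; apply/det0P => -[v v0 vA].
case/eqP: v0; apply: trmx_inj; rewrite trmx0; apply: herm_nondeg => w.
have Av : A *m v^T = 0 by apply: trmx_inj; rewrite trmx_mul trmxK vA trmx0.
by rewrite -uA Av -[0](scale0r 0) hermZl mul0r.
Qed.

Lemma is_U21_1 : is_U21 (1%:M : 'M[R[i]]_3).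
Proof. by apply/asboolP => z w; rewrite !mul1mx. Qed.

Lemma is_U21M A B : is_U21 A -> is_U21 B -> is_U21 (A *m B).
Proof.
by move=> /asboolP uA /asboolP uB; apply/asboolP => z w; rewrite -!mulmxA uA uB.
Qed.

Lemma is_U21V A : is_U21 A -> is_U21 (invmx A).
Proof.
move=> uA; apply/asboolP => z w; have /asboolP <- := uA.
by rewrite !mulmxA mulmxV ?is_U21_unit// !mul1mx.
Qed.

Definition U21_one : U21 R := MkU21 is_U21_1.
Definition U21_mul (A B : U21 R) : U21 R := MkU21 (is_U21M (U21P A) (U21P B)).
Definition U21_inv (A : U21 R) : U21 R := MkU21 (is_U21V (U21P A)).

Lemma U21_mulA : associative U21_mul.
Proof. by move=> A B D; apply: val_inj; exact: mulmxA. Qed.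
Lemma U21_mul1 : left_id U21_one U21_mul.
Proof. by move=> A; apply: val_inj; exact: mul1mx. Qed.
Lemma U21_mulr1 : right_id U21_one U21_mul.
Proof. by move=> A; apply: val_inj; exact: mulmx1. Qed.
Lemma U21_mulV : left_inverse U21_one U21_inv U21_mul.
Proof.
by move=> A; apply: val_inj => /=; rewrite mulVmx ?(is_U21_unit (U21P A)).
Qed.
Lemma U21_mulrV : right_inverse U21_one U21_inv U21_mul.
Proof.
by move=> A; apply: val_inj => /=; rewrite mulmxV ?(is_U21_unit (U21P A)).
Qed.

HB.instance Definition _ := isGroup.Build (U21 R)
  U21_mulA U21_mul1 U21_mulr1 U21_mulV U21_mulrV.

Definition proj_equiv (A B : U21 R) : bool :=
  `[< exists2 a : R[i], a != 0 & val A = a *: val B >].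

Lemma proj_equiv_refl : reflexive proj_equiv.
Proof. by move=> A; apply/asboolP; exists 1; rewrite ?oner_neq0 ?scale1r. Qed.

Lemma proj_equiv_sym : symmetric proj_equiv.
Proof.
have imp (A B : U21 R) : proj_equiv A B -> proj_equiv B A.
  move=> /asboolP[a a0 AB]; apply/asboolP; exists a^-1; rewrite ?invr_eq0//.
  by rewrite AB scalerA mulVf ?scale1r.
by move=> A B; apply/idP/idP; exact: imp.
Qed.

Lemma proj_equiv_trans : transitive proj_equiv.
Proof.
move=> B A D /asboolP[a a0 AB] /asboolP[b b0 BD]; apply/asboolP.
by exists (a * b); rewrite ?mulf_neq0// AB BD scalerA.
Qed.

Canonical proj_equiv_rel :=
  EquivRel proj_equiv proj_equiv_refl proj_equiv_sym proj_equiv_trans.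

End U21Group.

Local Open Scope quotient_scope.

(* U(2,1) modulo scalar matrices, with the quotient topology. *)
Definition PU21 (R : realType) : Type :=
  quotient_topology {eq_quot (@proj_equiv R)}.

HB.instance Definition _ (R : realType) :=
  Quotient.copy (PU21 R) (quotient_topology {eq_quot (@proj_equiv R)}).
HB.instance Definition _ (R : realType) :=
  EqQuotient.copy (PU21 R) {eq_quot (@proj_equiv R)}.
HB.instance Definition _ (R : realType) :=
  Topological.copy (PU21 R) (quotient_topology {eq_quot (@proj_equiv R)}).

Section PU21Group.
Variable R : realType.
Implicit Types x y : PU21 R.

Definition PU21_one : PU21 R := \pi_(PU21 R) 1%g.
Definition PU21_mul x y : PU21 R := \pi_(PU21 R) (repr x * repr y)%g.
Definition PU21_inv x : PU21 R := \pi_(PU21 R) (repr x)^-1%g.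

Lemma PU21_eqP (A B : U21 R) :
  reflect (exists2 a : R[i], a != 0 & val A = a *: val B)
    (\pi_(PU21 R) A == \pi_(PU21 R) B).
Proof. by rewrite eqquotE; exact: asboolP. Qed.

Lemma PU21_reprP (A : U21 R) :
  exists2 a : R[i], a != 0 & val (repr (\pi_(PU21 R) A)) = a *: val A.
Proof. by apply/PU21_eqP; rewrite reprK. Qed.

Lemma PU21_piM (A B : U21 R) :
  PU21_mul (\pi_(PU21 R) A) (\pi_(PU21 R) B) = \pi_(PU21 R) (A * B)%g.
Proof.
have [a a0 Aa] := PU21_reprP A; have [b b0 Bb] := PU21_reprP B.
apply/eqP/PU21_eqP; exists (a * b); first by rewrite mulf_neq0.
by rewrite /= Aa Bb -scalemxAl -scalemxAr scalerA.
Qed.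

Lemma PU21_piV (A : U21 R) : PU21_inv (\pi_(PU21 R) A) = \pi_(PU21 R) A^-1%g.
Proof.
have [a a0 Aa] := PU21_reprP A.
apply/eqP/PU21_eqP; exists a^-1; first by rewrite invr_eq0.
by rewrite /= Aa invmxZ// -Aa; apply/is_U21_unit/U21P.
Qed.

Lemma PU21_mulA : associative PU21_mul.
Proof.
move=> x y z; rewrite -[x]reprK -[y]reprK -[z]reprK.
move: (repr x) (repr y) (repr z) => A B D.
by rewrite (PU21_piM B D) (PU21_piM A B) (PU21_piM A) (PU21_piM _ D) mulgA.
Qed.
Lemma PU21_mul1 : left_id PU21_one PU21_mul.
Proof. by elim/quotW=> A; rewrite PU21_piM mul1g. Qed.
Lemma PU21_mulr1 : right_id PU21_one PU21_mul.
Proof. by elim/quotW=> A; rewrite PU21_piM mulg1. Qed.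
Lemma PU21_mulV : left_inverse PU21_one PU21_inv PU21_mul.
Proof. by elim/quotW=> A; rewrite PU21_piV PU21_piM mulVg. Qed.
Lemma PU21_mulrV : right_inverse PU21_one PU21_inv PU21_mul.
Proof. by elim/quotW=> A; rewrite PU21_piV PU21_piM mulgV. Qed.

HB.instance Definition _ := isGroup.Build (PU21 R)
  PU21_mulA PU21_mul1 PU21_mulr1 PU21_mulV PU21_mulrV.

End PU21Group.

Definition discrete_in (T : topologicalType) (G : set T) : Prop :=
  G `<=` isolated G.

Definition PU21_act (R : realType) (g : PU21 R) (p : {vspace C3 R}) :
  {vspace C3 R} := (linfun (mulmx (U21val (repr g))) @: p)%VS.

Definition bd_fixed (R : realType) (g : PU21 R) : set {vspace C3 R} :=
  [set p | bdH2C R p /\ PU21_act g p = p].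

Definition parabolic (R : realType) (g : PU21 R) : Prop :=
  (bd_fixed g #= `I_1)%card.
Definition loxodromic (R : realType) (g : PU21 R) : Prop :=
  (bd_fixed g #= `I_2)%card.
Definition elliptic (R : realType) (g : PU21 R) : Prop :=
  ~ parabolic g /\ ~ loxodromic g.

(* The projective line polar to n, of which the complex geodesic and its ideal
   boundary are the parts in H2C and bdH2C. *)
Definition polar_line (R : realType) (n : C3 R) : set {vspace C3 R} :=
  [set p : {vspace C3 R} | forall z, z \in p -> herm z n = 0].

Definition mirror (R : realType) (n : C3 R) : set {vspace C3 R} :=
  polar_line n `&` H2C R.
Definition bd_mirror (R : realType) (n : C3 R) : set {vspace C3 R} :=
  polar_line n `&` bdH2C R.

Definition ultra_parallel (R : realType) (n n' : C3 R) : Prop :=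
  mirror n `&` mirror n' = set0 /\ bd_mirror n `&` bd_mirror n' = set0.
Definition asymptotic (R : realType) (n n' : C3 R) : Prop :=
  mirror n `&` mirror n' = set0 /\ bd_mirror n `&` bd_mirror n' !=set0.

Definition geod_dist (R : realType) (C D : set {vspace C3 R}) : R :=
  inf [set hdist p q | p in C & q in D].

Definition refl (R : realType) (n z : C3 R) : C3 R :=
  - z + (2 * herm z n / herm n n) *: n.
Definition refl_mx (R : realType) (n : C3 R) : 'M[R[i]]_3 :=
  \matrix_(i, j) refl n (delta_mx j 0) i 0.

Lemma herm_sum_delta (R : realType) (z n : C3 R) :
  herm z n = \sum_j z j 0 * herm (delta_mx j 0) n.
Proof.
rewrite {1}(matrix_sum_delta z).
under eq_bigr do rewrite big_ord1.
by rewrite !big_ord_recr !big_ord0 /= !add0r !hermDl !hermZl.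
Qed.

Lemma refl_mxE (R : realType) (n z : C3 R) : refl_mx n *m z = refl n z.
Proof.
apply/matrixP => i j; rewrite ord1 {j} !mxE herm_sum_delta.
under eq_bigr do rewrite !mxE andbT mulrDl mulNr.
rewrite big_split sumrN /=; congr (- _ + _).
  rewrite (bigD1 i)//= eqxx mul1r big1 ?addr0// => k ki.
  by rewrite eq_sym (negbTE ki) mul0r.
rewrite mulr_sumr !mulr_suml; apply: eq_bigr => k _.
move: (herm _ _) (herm _ _) (n i 0) (z k 0) => a b c d.
by rewrite (mulrCA 2) -2!(mulrA d) [RHS]mulrC.
Qed.

(* If <n, n> = 0, then refl n z = - z because of the convention x / 0 = 0. *)
Lemma refl_mx_U21 (R : realType) (n : C3 R) : is_U21 (refl_mx n).
Proof.
apply/asboolP => z w; rewrite !refl_mxE /refl -(scaleN1r z) -(scaleN1r w).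
rewrite !hermDl !hermDr !hermZl !hermZr -(herm_conj w n).
have hn : (herm n n)^* = herm n n by exact: herm_conj.
rewrite !rmorphM fmorphV /= hn rmorphN /= conjC1 conjC_nat.
move: (herm z w) (herm n n) (herm z n) (herm w n)^* => a h b c.
have [->|h0] := eqVneq h 0; first by rewrite !invr0; ring.
by field.
Qed.

Definition creflection (R : realType) (n : C3 R) : PU21 R :=
  \pi_(PU21 R) (MkU21 (refl_mx_U21 n)).

(* The group <i_1, i_2, i_3 | i_j ^ 2 = 1>, as the reduced words in the three
   involutions; the lemmas Gamma_lift and Gamma_ext below are the universal
   property of this presentation. *)
Definition reduced (w : seq 'I_3) : bool := sorted (fun a b => a != b) w.

Record Gamma := MkGamma { gword :> seq 'I_3; gwordP : reduced gword }.

HB.instance Definition _ := [isSub for gword].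
HB.instance Definition _ := [Choice of Gamma by <:].

Definition wpush (j : 'I_3) (w : seq 'I_3) : seq 'I_3 :=
  if w is k :: w' then if j == k then w' else j :: w else [:: j].
Definition wmul (u v : seq 'I_3) : seq 'I_3 := foldr wpush v u.

Lemma wpush_reduced j w : reduced w -> reduced (wpush j w).
Proof.
case: w => //= k w kw; case: eqVneq => [_|jk]; first exact: path_sorted kw.
by rewrite /reduced /= jk.
Qed.

Lemma wpush_cons j w : reduced (j :: w) -> wpush j w = j :: w.
Proof. by case: w => //= k w /andP[/negbTE->]. Qed.

Lemma wpushK j w : reduced w -> wpush j (wpush j w) = w.
Proof.
case: w => /= [|k w kw]; first by rewrite eqxx.
by case: eqVneq => [->|jk] /=; rewrite ?eqxx// wpush_cons.
Qed.

Lemma wmul_reduced u v : reduced v -> reduced (wmul u v).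
Proof. by move=> rv; elim: u => //= j u; exact: wpush_reduced. Qed.

Lemma wmul_push j u v :
  reduced v -> wmul (wpush j u) v = wpush j (wmul u v).
Proof.
move=> rv; case: u => //= k u; case: eqVneq => [->|//].
by rewrite wpushK// wmul_reduced.
Qed.

Lemma wmulA u v w : reduced w -> wmul u (wmul v w) = wmul (wmul u v) w.
Proof. by move=> rw; elim: u => //= j u ->; rewrite wmul_push. Qed.

Lemma wmul_nil u : reduced u -> wmul u [::] = u.
Proof.
elim: u => //= j u IHu ru; rewrite IHu ?wpush_cons//; exact: path_sorted ru.
Qed.

Lemma wmul_revK u v : reduced v -> wmul (rev u) (wmul u v) = v.
Proof.
move=> rv; elim: u => //= j u IHu; rewrite rev_cons /wmul foldr_rcons.
by rewrite wpushK ?wmul_reduced.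
Qed.

Lemma rev_reduced u : reduced u -> reduced (rev u).
Proof.
by rewrite /reduced rev_sorted; apply: sub_sorted => a b; rewrite eq_sym.
Qed.

Definition Gamma_one : Gamma := @MkGamma [::] isT.
Definition Gamma_mul (u v : Gamma) : Gamma :=
  MkGamma (wmul_reduced u (gwordP v)).
Definition Gamma_inv (u : Gamma) : Gamma := MkGamma (rev_reduced (gwordP u)).

Lemma Gamma_mulA : associative Gamma_mul.
Proof. by move=> u v w; apply: val_inj; apply: wmulA; exact: gwordP. Qed.
Lemma Gamma_mul1 : left_id Gamma_one Gamma_mul.
Proof. by move=> u; exact: val_inj. Qed.
Lemma Gamma_mulr1 : right_id Gamma_one Gamma_mul.
Proof. by move=> u; apply: val_inj; apply: wmul_nil; exact: gwordP. Qed.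
Lemma Gamma_mulV : left_inverse Gamma_one Gamma_inv Gamma_mul.
Proof.
move=> u; apply: val_inj; rewrite /= -{2}(wmul_nil (gwordP u)).
exact: wmul_revK.
Qed.
Lemma Gamma_mulrV : right_inverse Gamma_one Gamma_inv Gamma_mul.
Proof.
move=> u; apply: val_inj; rewrite /= -{1}[gword u]revK.
by rewrite -{2}(wmul_nil (rev_reduced (gwordP u))) wmul_revK.
Qed.

HB.instance Definition _ := isGroup.Build Gamma
  Gamma_mulA Gamma_mul1 Gamma_mulr1 Gamma_mulV Gamma_mulrV.

Definition gen (j : 'I_3) : Gamma := @MkGamma [:: j] isT.

Lemma gen_sqr j : (gen j * gen j = 1)%g.
Proof. by apply: val_inj; rewrite /= eqxx. Qed.

Definition gen_eval (G : groupType) (f : 'I_3 -> G) (w : seq 'I_3) : G :=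
  (\prod_(j <- w) f j)%g.

Lemma gen_eval_mul (G : groupType) (f : 'I_3 -> G) u v :
  (forall j, (f j * f j = 1)%g) ->
  (gen_eval f (wmul u v) = gen_eval f u * gen_eval f v)%g.
Proof.
move=> ff; rewrite /gen_eval.
elim: u => [|j u IHu] /=; first by rewrite big_nil mul1g.
rewrite [in RHS]big_cons -mulgA -IHu; case: (wmul u v) => [|k w] /=.
  by rewrite big_cons.
by case: eqVneq => [->|_]; rewrite !big_cons// mulgA ff mul1g.
Qed.

Lemma Gamma_lift (G : groupType) (f : 'I_3 -> G) :
  (forall j, (f j * f j = 1)%g) ->
  exists phi : {multiplicative Gamma -> G}, forall j, phi (gen j) = f j.
Proof.
move=> ff; pose phi (u : Gamma) : G := gen_eval f u.
have phiM : {morph phi : u v / (u * v)%g} by move=> u v; exact: gen_eval_mul.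
pose phi_mixin := isMultiplicative.Build Gamma G phi phiM.
pose Phi : {multiplicative Gamma -> G} := HB.pack phi phi_mixin.
by exists Phi => j; rewrite /= /phi /gen_eval big_seq1.
Qed.

Lemma Gamma_ext (G : groupType) (phi psi : {multiplicative Gamma -> G}) :
  (forall j, phi (gen j) = psi (gen j)) -> phi =1 psi.
Proof.
move=> e; have one (f : {multiplicative Gamma -> G}) : (f 1 = 1)%g.
  by apply: (@mulgI _ (f 1%g)); rewrite -gmulfM !mulg1.
case=> w rw; elim: w rw => [|j w IHw] rw.
  have -> : MkGamma rw = 1%g by exact: val_inj.
  by rewrite !one.
have rw' : reduced w := path_sorted rw.
have -> : MkGamma rw = (gen j * MkGamma rw')%g.
  by apply: val_inj; rewrite /= wpush_cons.
by rewrite !gmulfM e IHw.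
Qed.

(* The vectors n j are polar to the mirrors; indices are taken modulo 3. *)
Definition triangle_config (R : realType) (m : 'I_3 -> R)
    (n : 'I_3 -> C3 R) : Prop :=
  [/\ forall j, 0 < herm (n j) (n j),
      injective (fun j => mirror (n j)),
      forall i j, i != j ->
        ultra_parallel (n i) (n j) \/ asymptotic (n i) (n j),
      forall j, geod_dist (mirror (n (j - 1))) (mirror (n (j + 1))) = m j &
      [/\ m 0 >= m 1, m 1 >= m 2%:R & m 2%:R >= 0]].

Definition triangle_rep (R : realType) (m : 'I_3 -> R) (n : 'I_3 -> C3 R)
    (phi : {multiplicative Gamma -> PU21 R}) : Prop :=
  triangle_config m n /\ forall j, phi (gen j) = creflection (n j).

Definition angular_invariant (R : realType) (n : 'I_3 -> C3 R) : R :=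
  carg (herm (n 0) (n 2%:R) * herm (n 1) (n 0) * herm (n 2%:R) (n 1)).

Definition discrete_rep (R : realType)
    (phi : {multiplicative Gamma -> PU21 R}) : Prop :=
  discrete_in (range phi).
Definition faithful_rep (R : realType)
    (phi : {multiplicative Gamma -> PU21 R}) : Prop :=
  injective phi.

(* A point of R^3 is (m_1, m_2, alpha); pr1, ..., ps2 are r_1, r_2, s_1, s_2. *)
Definition pm1 (R : realType) (x : 'rV[R]_3) : R := x 0 0.
Definition pm2 (R : realType) (x : 'rV[R]_3) : R := x 0 1.
Definition palpha (R : realType) (x : 'rV[R]_3) : R := x 0 2%:R.

Definition pr1 (R : realType) (x : 'rV[R]_3) : R := cosh (pm1 x / 2).
Definition pr2 (R : realType) (x : 'rV[R]_3) : R := cosh (pm2 x / 2).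
Definition ps1 (R : realType) (x : 'rV[R]_3) : R := sinh (pm1 x / 2).
Definition ps2 (R : realType) (x : 'rV[R]_3) : R := sinh (pm2 x / 2).

Definition sides (R : realType) (x : 'rV[R]_3) (j : 'I_3) : R :=
  [:: pm1 x; pm2 x; 0]`_j.

Definition col3 (R : realType) (a b c : R[i]) : C3 R :=
  \col_i [:: a; b; c]`_i.

Definition polar (R : realType) (x : 'rV[R]_3) (j : 'I_3) : C3 R :=
  let theta := (pi - palpha x) / 2 in
  let sqrt2 : R := Num.sqrt 2 in
  [:: col3 ((sqrt2 * pr2 x)%:C%C * expi (- theta)) 1 0;
      col3 (- ((sqrt2 * pr1 x)%:C%C * expi theta)) 1 0;
      col3 (sqrt2^-1)%:C%C 0 (sqrt2^-1)%:C%C]`_j.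

Definition coordX (R : realType) (x : 'rV[R]_3) : R :=
  (pr1 x ^+ 2 - 1) / (pr2 x ^+ 2 - 1) - 1.
Definition coordY (R : realType) (x : 'rV[R]_3) : R :=
  1 / (pr2 x ^+ 2 - 1).

Definition Kpoly (R : realType) (n : nat) (X Y : R) : R :=
  - n%:R ^+ 2 * (X ^+ 2 + Y ^+ 2)
  + n%:R * (X ^+ 2 - Y ^+ 2 + 4 * (Y + 1) * X) - 2 * X - 4 * Y - 4.

(* m_1 >= m_2 > m_3 = 0 are the standing assumptions on the side lengths. *)
Definition Kset (R : realType) (n : nat) : set 'rV[R]_3 :=
  [set x | [/\ pm2 x <= pm1 x, 0 < pm2 x, 0 < coordY x & 0 <= palpha x <= pi]
    /\ [/\ 2 / n%:R <= coordX x,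
           (1 < n)%N -> coordX x <= 2 / (n%:R - 1) &
           0 <= Kpoly n (coordX x) (coordY x)]].
Arguments Kset R n : clear implicits.

Definition monomial_term (R : realType) (d : nat)
    (c : {ffun 'I_d -> nat} -> R) (a x : 'rV[R]_d) (nu : {ffun 'I_d -> nat}) : R :=
  c nu * \prod_i (x 0 i - a 0 i) ^+ nu i.

(* Near a, the power series with coefficients c converges absolutely to f; the
   partial sums are over the boxes {0, ..., N - 1}^d of multi-indices. *)
Definition analytic_at (R : realType) (d : nat) (f : 'rV[R]_d -> R)
    (a : 'rV[R]_d) : Prop :=
  exists c : {ffun 'I_d -> nat} -> R, \forall x \near a,
    cvgn (fun N => \sum_(nu : {ffun 'I_d -> 'I_N})
                     `|monomial_term c a x [ffun i => nat_of_ord (nu i)]|)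
    /\ (fun N => \sum_(nu : {ffun 'I_d -> 'I_N})
                     monomial_term c a x [ffun i => nat_of_ord (nu i)])
         @ \oo --> f x.

Definition semi_analytic (R : realType) (d : nat) (A : set 'rV[R]_d) : Prop :=
  forall a : 'rV[R]_d, exists U : set 'rV[R]_d,
    [/\ open U, U a &
      exists (p q : nat) (f g : 'I_p -> 'I_q -> 'rV[R]_d -> R),
        (forall i j x, U x -> analytic_at (f i j) x /\ analytic_at (g i j) x) /\
        A `&` U = U `&` [set x | exists i, forall j, f i j x = 0 /\ 0 < g i j x]].

(* Main.v *)
(** The reflections R1, R2 fix the point at infinity and act on the Heisenberg
    group as half-turns about vertical lines over a1 and a2, so <R1, R2> is an
    infinite dihedral group whose half-turns have their axes over the points
    a1 + k (a2 - a1), while R3 exchanges the inside and the outside of the unit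
    Cygan sphere. R1 (R2 R1)^n R3 is the product of two reflections, the first
    one in the vertical complex line over a1 - n (a2 - a1), and it is elliptic
    exactly when this line meets the mirror of R3. It is then a rotation in a
    definite plane, so some nontrivial powers of it come arbitrarily close to 1.
    Otherwise the defining inequalities of K_n say that the half-turn
    R1 (R2 R1)^n is the one whose axis is closest to the centre of the sphere,
    and that the translation R2 R1 has Cygan length at least 2. So every
    nontrivial element of <R1, R2> maps the inside of the sphere to the outside,
    and ping-pong applies. *)

From HB Require Import structures.
Require Import Defs.
From mathcomp Require Import all_boot all_order all_algebra.
From mathcomp Require Import all_classical all_reals all_analysis.
From mathcomp Require Import complex.
From mathcomp Require Import ring lra zify.

Set Implicit Arguments.
Unset Strict Implicit.
Unset Printing Implicit Defensive.

Import Order.TTheory GRing.Theory Num.Theory.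
Import numFieldNormedType.Exports.
Local Open Scope classical_set_scope.
Local Open Scope ring_scope.
Local Open Scope quotient_scope.

(** * Inequalities between the sides *)

(** Put [S1], [S2] for the squares of [sinh(m_j/2)], and let [D] be half the squared distance
    between [a1] and [a2]; for fixed [m1], [m2], only [D] depends on the angle. Half the squared
    modulus of the centre of index [k] is [1 + S2 + k (S1 - S2) + k (k - 1) D], and the translation
    is long enough exactly when [1 + (S1 - S2)^2 <= 2 D (S1 + S2 + 2)]. All these conditions are
    linear in [D] and only improve as [D] grows, while non-ellipticity of the test element, whose
    centre has index [-n], is a lower bound for [D]. So each condition need only be checked at that
    bound, where [D] disappears: the comparison with the other half-turns becomes
    [2/n <= X <= 2/(n-1)], and the translation length becomes the polynomial inequality. This is why
    the angle does not occur in these three inequalities. Discreteness is not read off from a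
    fundamental domain. Ping-pong shows that no nontrivial word satisfies a certain open condition
    that the identity satisfies, and this isolates the identity. *)

Section RealInequalities.
Context {R : realFieldType}.
Implicit Types S De D : R.

(** Eliminating [D] between the cases [m] and [n] leaves the remainder
    [(m - n) (m n De - S (m + n + 1))]. At [m = n + 1] its sign is that of [n De - 2 S], at
    [m = n - 1] that of [2 S - (n - 1) De]: the two bounds on [De] are what the two neighbours of
    [n] require. *)
Lemma centers_far (n m : nat) S De D : (0 < n)%N -> (0 < m)%N -> 0 < S ->
  2 * S <= n%:R * De -> (n%:R - 1) * De <= 2 * S ->
  0 <= S - n%:R * De + n%:R * (n%:R + 1) * D ->
  0 <= S - m%:R * De + m%:R * (m%:R + 1) * D.
Proof.
move=> n0 m0 S0 lo hi Dn.
have N1 : 1 <= n%:R :> R by rewrite ler1n.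
have M1 : 1 <= m%:R :> R by rewrite ler1n.
(* Integrality matters: for real [m] strictly between [n - 1] and [n + 1] the remainder can be
   negative. *)
have cases : [\/ m%:R = n%:R :> R, m%:R + 1 <= n%:R :> R | n%:R + 1 <= m%:R :> R].
  case: (ltngtP m n) => [mn|nm|->]; [constructor 2|constructor 3|by constructor 1];
  by rewrite natr1 ler_nat.
move: (n%:R) (m%:R) N1 M1 lo hi Dn cases => N M N1 M1 lo hi Dn cases.
have NN0 : 0 < N * (N + 1) by apply: mulr_gt0; lra.
rewrite -(pmulr_rge0 _ NN0).
have -> : N * (N + 1) * (S - M * De + M * (M + 1) * D) =
  M * (M + 1) * (S - N * De + N * (N + 1) * D) +
  (M - N) * (M * (N * De) - S * (M + N + 1)) by ring.
apply: addr_ge0; first by apply: mulr_ge0 => //; apply: mulr_ge0; lra.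
case: cases => [->|MN|NM]; first by rewrite subrr mul0r.
- have De0 : 0 <= De by nra.
  rewrite -mulrNN; apply: mulr_ge0; first lra.
  have : M * ((N - 1) * De) <= M * (2 * S) by apply: ler_wpM2l => //; lra.
  have : 0 <= De * (N - M - 1) by apply: mulr_ge0; lra.
  have [N1'|N1'] : N = 1 \/ 1 < N by case: (eqVneq N 1) => [|h]; [left|right; rewrite lt_def h].
    nra.
  move=> h1 h2; rewrite oppr_ge0 subr_le0 -(ler_pM2l (_ : 0 < N - 1)); last lra.
  have : N * (M * ((N - 1) * De)) <= N * (M * (2 * S)) by apply: ler_wpM2l => //; lra.
  (* The factor is [(N - 1) (M + N + 1) - 2 N M], the slack left once [(N - 1) De] is replaced by
     [2 S]. *)
  have : 0 <= S * ((N + 1) * (N - M - 1)).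
    by apply: mulr_ge0; [lra|apply: mulr_ge0; lra].
  nra.
- apply: mulr_ge0; first lra.
  have : M * (2 * S) <= M * (N * De) by apply: ler_wpM2l => //; lra.
  nra.
Qed.

(** The last hypothesis bounds [D] from below. With [D] replaced by this bound, the conclusion
    multiplied by [n (n + 1)] is literally the polynomial hypothesis. *)
Lemma translation_far (n : nat) S1 S2 D : (0 < n)%N -> 0 < S2 -> S2 <= S1 ->
  0 <= - n%:R ^+ 2 * ((S1 - S2) ^+ 2 + 1)
     + n%:R * ((S1 - S2) ^+ 2 - 1 + 4 * (1 + S2) * (S1 - S2))
     - 2 * (S1 - S2) * S2 - 4 * S2 - 4 * S2 ^+ 2 ->
  0 <= S2 - n%:R * (S1 - S2) + n%:R * (n%:R + 1) * D ->
  1 + (S1 - S2) ^+ 2 <= 2 * D * (S1 + S2 + 2).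
Proof.
move=> n0 S20 S12 K Dn.
have N1 : 1 <= n%:R :> R by rewrite ler1n.
move: (n%:R) N1 K Dn => N N1 K Dn.
have NN0 : 0 < N * (N + 1) by apply: mulr_gt0; lra.
rewrite -(ler_pM2l NN0).
have : 0 <= (S1 + S2 + 2) * (S2 - N * (S1 - S2) + N * (N + 1) * D).
  by apply: mulr_ge0 => //; lra.
nra.
Qed.

End RealInequalities.

(** * Null vectors and the Cygan metric *)

Section Vectors.
Context {R : realType}.
Implicit Types (a b c : R[i]) (z w n : C3 R).

Lemma col3E a b c : (col3 a b c 0 0 = a) * (col3 a b c 1 0 = b) *
  (col3 a b c 2%:R 0 = c).
Proof. by rewrite !mxE. Qed.

Lemma col3_eta z : z = col3 (z 0 0) (z 1 0) (z 2%:R 0).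
Proof.
apply/matrixP => i j; rewrite ord1 mxE.
by case: i => [[|[|[|//]]] hi] /=; congr (z _ _); apply: val_inj.
Qed.

Lemma col3_ext z w : z 0 0 = w 0 0 -> z 1 0 = w 1 0 -> z 2%:R 0 = w 2%:R 0 ->
  z = w.
Proof. by rewrite (col3_eta z) (col3_eta w) !col3E => -> -> ->. Qed.

Lemma col3Z k a b c : k *: col3 a b c = col3 (k * a) (k * b) (k * c).
Proof. by apply: col3_ext; rewrite !(col3E, mxE). Qed.

Lemma herm_col3 a b c a' b' c' :
  herm (col3 a b c) (col3 a' b' c') = a * c'^* + b * b'^* + c * a'^*.
Proof. by rewrite /herm !col3E. Qed.

Lemma refl_linear n : linear (refl n).
Proof.
move=> k z w; rewrite /refl hermDl hermZl.
by apply: col3_ext; rewrite !mxE; ring.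
Qed.

HB.instance Definition _ n := GRing.isLinear.Build R[i] (C3 R) (C3 R) _
  (refl n) (refl_linear n).

Lemma refl_herm n z w : herm (refl n z) (refl n w) = herm z w.
Proof. by rewrite -!refl_mxE; have /asboolP := refl_mx_U21 n. Qed.

Lemma reflK n : herm n n != 0 -> involutive (refl n).
Proof.
move=> n0 z; have -> : refl n (refl n z) =
    - refl n z + (2 * herm (refl n z) n / herm n n) *: n by [].
have -> : herm (refl n z) n = herm z n.
  by rewrite /refl hermDl -scaleN1r !hermZl; field.
by apply: col3_ext; rewrite !mxE; ring.
Qed.

(** Vectors orthogonal to it with last coordinate 1 have middle coordinate minus the conjugate of
    [a]. The vertical line thus lies over that point rather than over [a], which leaves all moduli
    unchanged. *)
Definition vert a : C3 R := col3 a 1 0.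
Definition unit3 : C3 R := let s : R := Num.sqrt 2 in
  col3 (s^-1)%:C%C 0 (s^-1)%:C%C.
Definition origin : C3 R := col3 0 0 1.
Definition infty : C3 R := col3 1 0 0.

Lemma herm_vert a b : herm (vert a) (vert b) = 1.
Proof. by rewrite herm_col3 rmorph0 rmorph1; ring. Qed.

Lemma refl_vertE a z : refl (vert a) z =
  col3 (- z 0 0 + 2 * a * (z 1 0 + z 2%:R 0 * a^*))
       (z 1 0 + 2 * z 2%:R 0 * a^*) (- z 2%:R 0).
Proof.
rewrite /refl herm_vert (col3_eta z) herm_col3.
by apply: col3_ext; rewrite !(col3E, mxE) rmorph0 rmorph1 divr1; ring.
Qed.

Lemma sqrt2V_sqr : ((Num.sqrt 2)^-1 : R)%:C%C ^+ 2 = 2^-1 :> R[i].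
Proof.
rewrite -rmorphXn /= exprVn sqr_sqrtr// fmorphV /=; congr (_ ^-1).
by rewrite rmorph_nat.
Qed.

Lemma herm_unit3 : herm unit3 unit3 = 1.
Proof.
rewrite herm_col3 rmorph0 mulr0 addr0.
rewrite [X in _ * X](_ : _ = ((Num.sqrt 2)^-1 : R)%:C%C); last exact: conjc_real.
by rewrite -expr2 sqrt2V_sqr; field.
Qed.

Lemma herm_unit3r z :
  herm z unit3 = ((Num.sqrt 2)^-1 : R)%:C%C * (z 0 0 + z 2%:R 0).
Proof.
rewrite (col3_eta z) herm_col3 rmorph0 mulr0 addr0 !col3E.
have -> : (((Num.sqrt 2)^-1 : R)%:C%C)^* = ((Num.sqrt 2)^-1 : R)%:C%C.
  exact: conjc_real.
by rewrite mulrDr mulrC [in LHS](mulrC (z _ _)).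
Qed.

Lemma refl_unit3E z : refl unit3 z = col3 (z 2%:R 0) (- z 1 0) (z 0 0).
Proof.
rewrite /refl herm_unit3 herm_unit3r divr1 /unit3.
have := sqrt2V_sqr; move: ((Num.sqrt 2)^-1 : R)%:C%C => t tt.
have {}tt : 2 * t ^+ 2 = 1 by rewrite tt mulfV ?pnatr_eq0.
by apply: col3_ext; rewrite !(col3E, mxE); ring: tt.
Qed.

End Vectors.

(** * Cygan balls and the triangle inequality *)

Section PingPong.
Context {R : realType}.
Implicit Types (a b c : R[i]) (P Q : C3 R).

Lemma null_norm a b : a + b * b^* + a^* = 0 -> `|b| ^+ 2 <= 2 * `|a|.
Proof.
move=> e; have bb : b * b^* = - (a + a^*).
  by apply/eqP; rewrite -subr_eq0 opprK -e; apply/eqP; ring.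
rewrite -[X in X <= _]ger0_norm ?exprn_ge0//.
by rewrite normCK bb normrN (le_trans (ler_normD _ _))// norm_conjC -mulr2n mulr_natl.
Qed.

(* The Cygan distance is d(P, Q)^2 = |P1 + P2 Q2^* + Q1^*|. *)
Lemma cygan_triangle (p1 p2 q1 q2 : R[i]) :
  p1 + p2 * p2^* + p1^* = 0 -> q1 + q2 * q2^* + q1^* = 0 ->
  `|p1 + p2 * q2^* + q1^*| < 1 -> 4 <= `|q1| -> 1 < `|p1|.
Proof.
move=> p0 q0; set s := p1 + _ + _ => s1 q4.
rewrite real_ltNge ?realE ?ler01 ?normr_ge0//; apply/negP => p1_le.
(* The relative position of the two points is again given by a null vector, with coordinates [s],
   [q2 - p2], 1, so [null_norm] bounds its horizontal part too. *)
have w0 : s + (q2 - p2) * (q2 - p2)^* + s^* = 0.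
  have -> : s + (q2 - p2) * (q2 - p2)^* + s^* =
    (p1 + p2 * p2^* + p1^*) + (q1 + q2 * q2^* + q1^*).
    by rewrite /s !(rmorphD, rmorphM, rmorphB) /= !conjCK; ring.
  by rewrite p0 q0 addr0.
have pw : `|p2| * `|q2 - p2| <= 2.
  rewrite -(@ler_pXn2r _ 2) ?nnegrE ?mulr_ge0// exprMn.
  apply: le_trans (_ : 2 * 2 <= _); last by rewrite expr2.
  apply: ler_pM; rewrite ?exprn_ge0//.
    by apply: (le_trans (null_norm p0)); rewrite ler_piMr.
  by apply: (le_trans (null_norm w0)); rewrite ler_piMr// ltW.
suff : `|q1| < 4 by move=> /(le_lt_trans q4); rewrite ltxx.
rewrite -norm_conjC (_ : q1^* = s + p1^* - p2 * (q2 - p2)^*); last first.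
  have -> : p1^* = - (p1 + p2 * p2^*).
    by apply/eqP; rewrite -subr_eq0 opprK -p0 addrC.
  by rewrite /s rmorphB; ring.
apply: le_lt_trans (ler_normB _ _) _; rewrite normrM norm_conjC.
have -> : 4 = 1 + 1 + 2 :> R[i] by ring.
apply: ltr_leD => //; apply: le_lt_trans (ler_normD _ _) _.
by rewrite norm_conjC ltr_leD.
Qed.

(** Homogeneous form of the triangle inequality: [P] is at distance less than 1 from [Q], and [Q] at
    distance at least 2 from the origin. The constant 4 is the square of 2, since [herm] gives
    squared Cygan distances. *)
Lemma null_sphere_out P Q : herm P P = 0 -> herm Q Q = 0 -> P 2%:R 0 != 0 ->
  Q 2%:R 0 != 0 -> `|herm P Q| < `|P 2%:R 0| * `|Q 2%:R 0| ->
  4 * `|Q 2%:R 0| <= `|Q 0 0| -> `|P 2%:R 0| < `|P 0 0|.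
Proof.
rewrite /herm; move: (P 0 0) (P 1 0) (P 2%:R 0) (Q 0 0) (Q 1 0) (Q 2%:R 0).
move=> p1 p2 p3 q1 q2 q3 P0 Q0 p3n q3n lt1 ge4.
have := @cygan_triangle (p1 / p3) (p2 / p3) (q1 / q3) (q2 / q3).
have p3n' : p3^* != 0 by rewrite conjC_eq0.
have q3n' : q3^* != 0 by rewrite conjC_eq0.
have np3 : 0 < `|p3| by rewrite normr_gt0.
have nq3 : 0 < `|q3| by rewrite normr_gt0.
rewrite !normf_div ltr_pdivlMr// mul1r ler_pdivlMr//; apply => //.
- apply: (mulIf (_ : p3 * p3^* != 0)); first by rewrite mulf_neq0.
  by rewrite mul0r -P0 !fmorph_div; field; rewrite p3n p3n'.
- apply: (mulIf (_ : q3 * q3^* != 0)); first by rewrite mulf_neq0.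
  by rewrite mul0r -Q0 !fmorph_div; field; rewrite q3n q3n'.
- rewrite (_ : _ + _ = (p1 * q3^* + p2 * q2^* + p3 * q1^*) / (p3 * q3^*)).
    by rewrite normf_div normrM norm_conjC ltr_pdivrMr ?mulr_gt0// mul1r.
  by rewrite !fmorph_div; field; rewrite p3n q3n'.
Qed.

End PingPong.

(** * Words in the reflections *)

Lemma addr1N_succ (m : nat) : 1 - m.+1%:Z = - m%:Z.
Proof. by lia. Qed.

Section Words.
Context {R : realType}.
Variables a1 a2 : R[i].
Implicit Types (z : C3 R) (i k : int).

Definition tri (j : 'I_3) : C3 R := [:: vert a1; vert a2; unit3]`_j.

Definition wact (w : seq 'I_3) z := foldr (fun j => refl (tri j)) z w.

Arguments tri : simpl never.
Arguments wact : simpl never.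

Definition center k : R[i] := a1 + k%:~R * (a2 - a1).

Local Notation H k := (refl (vert (center k))).

Lemma center0 : center 0 = a1.
Proof. by rewrite /center mul0r addr0. Qed.

Lemma center1 : center 1 = a2.
Proof. by rewrite /center mul1r addrC subrK. Qed.

Lemma refl_vertK a : involutive (refl (vert a : C3 R)).
Proof. by apply: reflK; rewrite herm_vert oner_neq0. Qed.

(** The horizontal part of the translation comes from the difference of the centres. The vertical
    part comes from the imaginary part of one centre times the conjugate of the other, and for
    centres in arithmetic progression this is [i - j] times a constant. *)
Lemma center_shift i (j : int) k z : H i (H j z) = H (i + k) (H (j + k) z).
Proof.
have conj_int (m : int) : (m%:~R : R[i])^* = m%:~R by exact: rmorph_int.
rewrite !refl_vertE /center !(rmorphD, rmorphM, rmorphB, intrD) /= !conj_int.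
by apply: col3_ext; rewrite !col3E; ring.
Qed.

Lemma tri0 : tri 0 = vert (center 0). Proof. by rewrite center0. Qed.
Lemma tri1 : tri 1 = vert (center 1). Proof. by rewrite center1. Qed.

Lemma wact_cons j u z : wact (j :: u) z = refl (tri j) (wact u z).
Proof. by []. Qed.

Lemma wact_cat u v z : wact (u ++ v) z = wact u (wact v z).
Proof. by rewrite /wact foldr_cat. Qed.

Lemma wact_herm u z (w : C3 R) : herm (wact u z) (wact u w) = herm z w.
Proof. by elim: u => //= j u IHu; rewrite !wact_cons refl_herm. Qed.

Lemma wact_linear u : linear (wact u).
Proof. by elim: u => [|j u IHu] k z w //; rewrite !wact_cons IHu linearP. Qed.

(* The composite H i (H j) is a Heisenberg translation that depends only on
   i - j, by center_shift; so the reduced words are the half-turns H k and the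
   nontrivial translations. *)
Lemma alternating_word (u : seq 'I_3) : reduced u -> all (fun j => j != 2%:R) u ->
  u <> [::] ->
  (exists k, wact u =1 H k) \/
  (exists i k, k != 0 /\ (forall z, wact u z = H i (H (i + k) z))).
Proof.
move=> ru u01 u0.
(* The head letter fixes the direction in which the index moves, and the parity of the length
   separates half-turns from translations. When a letter is put before a translation, [center_shift]
   is applied with the shift that makes the last two half-turns cancel. *)
suff : (ohead u = Some 0 ->
    (exists m : nat, wact u =1 H (- m%:Z)) \/
    (exists m : nat, forall z, wact u z = H 0 (H m.+1%:Z z))) /\
  (ohead u = Some 1 ->
    (exists m : nat, wact u =1 H (1 + m%:Z)) \/
    (exists m : nat, forall z, wact u z = H 1 (H (- m%:Z) z))).
  case: u u01 {ru u0} (u0) => [//|j u] /andP[j2 _] _ /= [h0 h1].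
  have : j = 0 \/ j = 1.
    case: j j2 {h0 h1} => [[|[|[|//]]] hj] //= _; [left|right]; exact: val_inj.
  case=> ej.
    case: h0 => [|[m hm]|[m hm]]; first by rewrite ej.
      by left; exists (- m%:Z).
    by right; exists 0, (m.+1%:Z); rewrite add0r.
  case: h1 => [|[m hm]|[m hm]]; first by rewrite ej.
    by left; exists (1 + m%:Z).
  right; exists 1, (- (m.+1)%:Z); split; first by rewrite oppr_eq0.
  by move=> z; rewrite hm addr1N_succ.
elim: u ru u01 u0 => // j u IHu ru /andP[j2 u01] _.
have [->|u0] := eqVneq u [::].
  split => -[->]; left; exists 0%N => z; rewrite wact_cons; first by rewrite tri0.
  by rewrite tri1 addr0.
have {IHu} := IHu (path_sorted ru) u01 (elimN eqP u0).
case: u ru u01 u0 => // j' u /andP[jj' _] /andP[j2' _] _ /= [h0 h1].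
split=> -[ej]; rewrite ej in jj' *.
  have : j' = 1.
    by case: j' jj' j2' {h0 h1} => [[|[|[|//]]] hj] //= _ _; exact: val_inj.
  move=> ej'; case: h1 => [|[m hm]|[m hm]]; first by rewrite ej'.
    by right; exists m => z; rewrite wact_cons hm tri0.
  left; exists m.+1 => z; rewrite wact_cons hm tri0.
  by rewrite (center_shift 0 1 (- m.+1%:Z)) add0r addr1N_succ refl_vertK.
have : j' = 0.
  by case: j' jj' j2' {h0 h1} => [[|[|[|//]]] hj] //= _ _; exact: val_inj.
move=> ej'; case: h0 => [|[m hm]|[m hm]]; first by rewrite ej'.
  by right; exists m => z; rewrite wact_cons hm tri1.
left; exists m.+1 => z; rewrite wact_cons hm tri1.
by rewrite (center_shift 1 0 m.+1%:Z) add0r refl_vertK.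
Qed.

Lemma center_power m z :
  H 0 (iter m (fun z => H 1 (H 0 z)) z) = H (- m%:Z) z.
Proof.
elim: m z => [|m IHm] z; first by [].
rewrite iterSr IHm (center_shift 1 0 (- m.+1%:Z)).
by rewrite addr1N_succ refl_vertK add0r.
Qed.

(** Both hypotheses put images of [origin] at Cygan distance at least 2 from it, that is, first
    coordinate of modulus at least 4. A half-turn gives twice the squared modulus of its centre, and
    [R2 R1] gives twice the square root of the right-hand side of [trans_far]. *)
Hypothesis far : forall k, 2 <= `|center k| ^+ 2.
Hypothesis trans_far :
  4 <= `|a2 - a1| ^+ 4 - (a2 * a1^* - a1 * a2^*) ^+ 2.

Definition inside z := (herm z z == 0) && (`|z 0 0| < `|z 2%:R 0|).
Definition outside z := (herm z z == 0) && (`|z 2%:R 0| < `|z 0 0|).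

Lemma alternating_origin (u : seq 'I_3) : reduced u ->
  all (fun j => j != 2%:R) u -> u <> [::] ->
  4 * `|wact u origin 2%:R 0| <= `|wact u origin 0 0|.
Proof.
move=> ru u01 u0; case: (alternating_word ru u01 u0) => [[k ->]|[i [k [k0 ->]]]].
  rewrite refl_vertE !col3E normrN normr1 mulr1 oppr0 !add0r mul1r -mulrA.
  rewrite -normCK normrM ger0_norm// ger0_norm ?exprn_ge0//.
  by rewrite [leLHS](_ : 4 = 2 * 2) ?ler_pM2l//; ring.
have conj_int (m : int) : (m%:~R : R[i])^* = m%:~R by exact: rmorph_int.
rewrite !refl_vertE !col3E !opprK normr1 mulr1.
set e := (X in _ <= `|X|); set w := a2 * a1^* - a1 * a2^*.
(* As [w] is purely imaginary, the two summands in [eE] are a real and an imaginary part. Hence the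
   modulus of [e] is least when [k ^+ 2 = 1]. *)
have wN : w^* = - w by rewrite /w rmorphB !rmorphM /= !conjCK; ring.
have eE : e = - (2 * k%:~R ^+ 2 * `|a2 - a1| ^+ 2 + 2 * k%:~R * w).
  rewrite normCK /e /w /center !(rmorphD, rmorphM, rmorphB, intrD, rmorph0) /=.
  by rewrite !conj_int; ring.
have tf : 4 <= `|a2 - a1| ^+ 4 - w ^+ 2 := trans_far.
clearbody w; rewrite -(@ler_pXn2r _ 2) ?nnegrE// eE normrN normCK.
rewrite !(rmorph_nat, rmorphD, rmorphM, rmorphXn) /= !conj_int wN.
rewrite (CrealP (normr_real _)).
rewrite [leRHS](_ : _ = 4 * k%:~R ^+ 2 *
  (k%:~R ^+ 2 * `|a2 - a1| ^+ 4 + `|w| ^+ 2)); last first.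
  by rewrite [`|w| ^+ 2]normCK wN; ring.
have k1 : 1 <= k%:~R ^+ 2 :> R[i] by rewrite -rmorphXn /= ler1z; nia.
apply: le_trans (_ : 4 * 1 * (1 * `|a2 - a1| ^+ 4 + `|w| ^+ 2) <= _).
  rewrite mulr1 mul1r (_ : 4 ^+ 2 = 4 * 4)// ler_pM2l//.
  by rewrite [`|w| ^+ 2]normCK wN mulrN -expr2.
apply: ler_pM; rewrite ?mul1r ?mulr1 ?addr_ge0 ?exprn_ge0//.
  by rewrite ler_peMr.
by rewrite lerD2r ler_peMl ?exprn_ge0.

Qed.

Lemma wact_height u z : all (fun j => j != 2%:R) u ->
  `|wact u z 2%:R 0| = `|z 2%:R 0|.
Proof.
elim: u => // j u IHu /andP[j2 u01]; rewrite wact_cons -(IHu u01).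
case: j j2 => [[|[|[|//]]] hj] //= _; rewrite /tri /= refl_vertE !col3E normrN//.
Qed.

Lemma wact_infty u : all (fun j => j != 2%:R) u ->
  wact u infty = (-1) ^+ size u *: infty.
Proof.
elim: u => [|j u IHu] /=; first by rewrite expr0 scale1r.
move=> /andP[j2 u01]; rewrite wact_cons (IHu u01) linearZ /= exprS -scalerA.
rewrite scalerA mulrC -scalerA; congr (_ *: _).
case: j j2 => [[|[|[|//]]] hj] //= _; rewrite /tri /= refl_vertE;
  by apply: col3_ext; rewrite !(col3E, mxE); ring.
Qed.

Definition inside_or_infty z :=
  inside z \/ exists2 e : R[i], e != 0 & z = e *: infty.

Lemma outside_infty e : e != 0 -> outside (e *: infty).
Proof.
move=> e0; rewrite /outside /infty col3Z herm_col3 !col3E !mulr0 mulr1.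
by rewrite normr0 normr_gt0 e0 rmorph0 !(mulr0, mul0r) !addr0 eqxx.
Qed.

(** The word preserves [herm] and the modulus of the last coordinate, so it carries the unit ball
    about [origin] to the unit ball about the image of [origin], which is at distance at least 2. *)
Lemma alternating_out (u : seq 'I_3) z : reduced u ->
  all (fun j => j != 2%:R) u -> u <> [::] ->
  inside_or_infty z -> outside (wact u z).
Proof.
move=> ru u01 u0 [/andP[/eqP zz zi]|[e e0 ->]]; last first.
  rewrite (_ : wact u _ = e *: wact u infty).
    rewrite wact_infty// scalerA; apply: outside_infty.
    by rewrite mulf_neq0// expf_neq0// oppr_eq0 oner_eq0.
  have := wact_linear u e infty 0; rewrite addr0 => ->.
  by have := wact_linear u (-1) 0 0; rewrite !scaleN1r !addNr => ->; rewrite addr0.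
have z2 : z 2%:R 0 != 0 by rewrite -normr_gt0 (le_lt_trans _ zi).
rewrite /outside wact_herm zz eqxx /=.
have o2 : `|wact u origin 2%:R 0| = 1 by rewrite wact_height// col3E normr1.
apply: (@null_sphere_out _ _ (wact u origin)).
- by rewrite wact_herm.
- by rewrite wact_herm herm_col3 rmorph0; ring.
- by rewrite -normr_gt0 wact_height// normr_gt0.
- by rewrite -normr_gt0 o2.
- rewrite wact_herm o2 mulr1 wact_height// (col3_eta z) herm_col3 !col3E.
  by rewrite rmorph0 rmorph1 mulr1 !mulr0 !addr0.
- exact: alternating_origin.
Qed.

Lemma refl_unit3_swap z : outside z -> inside (refl unit3 z).
Proof. by rewrite /inside /outside refl_herm refl_unit3E !col3E. Qed.

(** The prefix [u] collects the letters of [R1] and [R2] since the last [R3], so that a whole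
    syllable is applied at once. Both [origin] and [infty] are followed because [R3] exchanges them;
    this is also why [infty] has to be allowed beside the inside. *)
Lemma pingpong_split (w : seq 'I_3) : reduced w -> exists u v : seq 'I_3,
  [/\ w = u ++ v, all (fun j => j != 2%:R) u,
      inside_or_infty (wact v origin), inside_or_infty (wact v infty) &
      v = [::] \/ ohead v = Some 2%:R /\ inside (wact v infty)].
Proof.
have i0 : inside_or_infty infty by right; exists 1; rewrite ?oner_neq0 ?scale1r.
have o0 : inside origin.
  rewrite /inside herm_col3 !col3E !rmorph0 normr0 normr1 ltr01 !mul0r mulr0.
  by rewrite !addr0 eqxx.
elim: w => [_|j w IHw jw]; first by exists [::], [::]; split => //; left.
have [u [v [e u01 vo vi v0]]] := IHw (path_sorted jw).
have [j2|j2] := eqVneq j 2%:R; last first.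
  by exists (j :: u), v; split => //=; rewrite ?e// j2.
exists [::], (j :: w); rewrite !wact_cons j2 [tri _]/(unit3).
have [u0|u0] := eqVneq u [::].
  (* Otherwise [v] would begin with the letter of [R3], and the word would not be reduced. The word
     is therefore [R3] alone, which exchanges the two test points. *)
  have {}v0 : v = [::].
    case: v0 => // -[v2 _]; move: jw; rewrite e u0 j2.
    by case: v v2 {e vo vi} => // k v [->] /andP[/eqP].
  have swap : (refl unit3 infty = origin :> C3 R) * (refl unit3 origin = infty :> C3 R).
    by rewrite !refl_unit3E !col3E oppr0.
  rewrite e u0 v0 /= /wact /= !swap; split=> //; by [left|right].
have out z : inside_or_infty z -> inside (refl unit3 (wact u z)).
  move=> hz; apply: refl_unit3_swap; apply: alternating_out => //; last exact/eqP.
  by have := path_sorted jw; rewrite e => /cat_sorted2[].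
rewrite e !wact_cat; split => //.
- by left; exact: out.
- by left; exact: out.
- by right; split=> //; exact: out.
Qed.

(** A word beginning with [R1] or [R2] sends [origin] outside; a word beginning with [R3] sends
    [infty] inside. Each contradicts one of the two inequalities. *)
Lemma pingpong (w : seq 'I_3) : reduced w -> w <> [::] ->
  ~ (`|wact w infty 2%:R 0| < `|wact w infty 0 0| /\
     `|wact w origin 0 0| < `|wact w origin 2%:R 0|).
Proof.
move=> rw w0 [Uinf Vo].
have [u [v [e u01 vo vi v0]]] := pingpong_split rw.
have [u0|u0] := eqVneq u [::]; last first.
  have ru : reduced u by move: rw; rewrite e => /cat_sorted2[].
  have /andP[_] := alternating_out ru u01 (elimN eqP u0) vo.
  by rewrite -wact_cat -e => /(lt_trans Vo); rewrite ltxx.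
case: v0 => [v0|[_ /andP[_]]]; first by rewrite e u0 v0 in w0.
by rewrite -[v]/([::] ++ v) -u0 -e => /(lt_trans Uinf); rewrite ltxx.
Qed.

End Words.

(** * Fixed points of a product of two reflections *)

Section Lines.
Context {K : fieldType} {V : vectType K}.
Implicit Types (v w : V).

Lemma vline_scale (k : K) v : k != 0 -> (<[k *: v]> = <[v]>)%VS.
Proof.
move=> k0; apply/eqP; rewrite eqEsubv -!memvE; apply/andP; split.
  by apply/vlineP; exists k.
by apply/vlineP; exists k^-1; rewrite scalerA mulVf// scale1r.
Qed.

Lemma vline_eq v w : (<[v]> = <[w]>)%VS -> v != 0 ->
  exists2 k : K, k != 0 & v = k *: w.
Proof.
move=> e v0; have /vlineP[k vk] : v \in <[w]>%VS by rewrite -e memv_line.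
by exists k => //; apply: contraNneq v0 => k0; rewrite vk k0 scale0r.
Qed.

End Lines.

Lemma card_eq_set2 (T : Type) (p q : T) : p <> q -> ([set p; q] #= `I_2)%card.
Proof.
move=> pq; have -> : [set p; q] = (fun i => if i == 0%N then p else q) @` `I_2.
  apply/seteqP; split=> x /=; first by case=> ->; [exists 0%N|exists 1%N].
  by case=> -[|[|//]] _ <-; [left|right].
apply: inj_card_eq => -[|[|i]] [|[|j]]; rewrite ?inE //= => _ _ e.
by case: pq; rewrite e.
Qed.

Section TwoReflections.
Context {R : realType}.
Implicit Types (z : C3 R) (m : R).

Lemma PU21_act_pi (A : U21 R) z :
  PU21_act (\pi_(PU21 R) A) <[z]> = <[val A *m z]>%VS.
Proof.
have [c c0 Ac] := PU21_reprP A.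
by rewrite /PU21_act limg_line lfunE /= Ac -scalemxAl vline_scale.
Qed.

Definition sqn (a : R[i]) : R := complex.Re a ^+ 2 + complex.Im a ^+ 2.

Lemma sqnE a : a * a^* = (sqn a)%:C%C.
Proof. by rewrite /sqn add_Re2_Im2 normCK. Qed.

Variables (a : R[i]) (A : U21 R).
Hypothesis AE : forall z, val A *m z = refl (vert a) (refl unit3 z).

(* The null eigenvectors for the eigenvalue m, normalized by their last coordinate. *)
Let fixed_vector m : C3 R :=
  col3 (- m%:C%C) (- (2 * a^* * m%:C%C / (m%:C%C + 1))) 1.

Lemma refl2E z : val A *m z =
  col3 (- z 2%:R 0 + 2 * a * (- z 1 0 + z 0 0 * a^*))
       (- z 1 0 + 2 * z 0 0 * a^*) (- z 0 0).
Proof. by rewrite AE refl_unit3E refl_vertE !col3E. Qed.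

(** The quadratic is the cofactor of [m - 1] in the characteristic polynomial. The eigenvalue 1
    needs no clause of its own: it has a null eigenvector only if [sqn a = 2], and then 1 is a root
    of the quadratic. *)
Let eigenvalues : set R := [set m | 0 < m /\ (m + 1) ^+ 2 = 2 * sqn a * m].

Let realc (x : R) : (x%:C%C)^* = x%:C%C. Proof. exact: conjc_real. Qed.

Let fixed_vectorP m : eigenvalues m ->
  herm (fixed_vector m) (fixed_vector m) = 0 /\
  val A *m fixed_vector m = m%:C%C *: fixed_vector m.
Proof.
move=> [m0 me].
have mc0 : m%:C%C + 1 != 0 :> R[i].
  by rewrite -(rmorph1 (real_complex R)) -rmorphD fmorph_eq0 lt0r_neq0// addr_gt0.
have mce : (m%:C%C + 1) ^+ 2 = 2 * (a * a^*) * m%:C%C.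
  by rewrite sqnE -(rmorph1 (real_complex R)) -rmorphD -rmorphXn /= me !rmorphM rmorph_nat.
split.
  rewrite herm_col3 rmorph1.
  rewrite !(rmorphN, rmorphM, fmorphV, rmorphD, rmorph1, rmorph_nat) /= realc conjCK.
  have -> : - m%:C%C * 1 + - (2 * a^* * m%:C%C / (m%:C%C + 1)) *
    - (2 * a * m%:C%C / (m%:C%C + 1)) + 1 * - m%:C%C =
    (2 * m%:C%C * (2 * (a * a^*) * m%:C%C) - 2 * m%:C%C * (m%:C%C + 1) ^+ 2) / (m%:C%C + 1) ^+ 2.
    by field.
  by rewrite mce subrr mul0r.
rewrite refl2E col3Z !col3E.
apply: col3_ext; rewrite !col3E; [|by field|by rewrite opprK mulr1].
apply/eqP; rewrite -subr_eq0; apply/eqP.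
set x : R[i] := m%:C%C in mc0 mce *.
have -> : - 1 + 2 * a * (- - (2 * a^* * x / (x + 1)) + - x * a^*) - x * - x =
  (x - 1) * ((x + 1) ^+ 2 - 2 * (a * a^*) * x) / (x + 1) by field.
by rewrite mce subrr mulr0 mul0r.
Qed.

Let fixed_vector_neq0 m : fixed_vector m != 0.
Proof.
apply/eqP => /(congr1 (fun z : C3 R => z 2%:R 0)).
by rewrite col3E mxE => /eqP; rewrite oner_eq0.
Qed.

(** Nullity of an eigenvector with coordinates [x], [y], 1 makes the squared modulus of [y] equal to
    twice the real part of the eigenvalue [k]. Together with the characteristic equation this forces
    [k] to be real and positive. *)
Lemma bd_fixedE : bd_fixed (\pi_(PU21 R) A) =
  [set <[fixed_vector m]>%VS | m in eigenvalues].
Proof.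
apply/seteqP; split=> [p [[z [z0 zz ->{p}]]]|p [m me <-{p}]]; last first.
  have [h0 hA] := fixed_vectorP me; split.
    by exists (fixed_vector m); split.
  rewrite PU21_act_pi hA vline_scale// fmorph_eq0.
  by case: me => m0 _; rewrite lt0r_neq0.
rewrite PU21_act_pi => fx.
have Az0 : val A *m z != 0.
  apply: contraNneq z0 => e; rewrite -[z]mul1mx -(mulVmx (is_U21_unit (U21P A))).
  by rewrite -mulmxA e mulmx0.
have [k k0] := vline_eq fx Az0; rewrite refl2E => Ak.
have e0 := congr1 (fun z : C3 R => z 0 0) Ak.
have e1 := congr1 (fun z : C3 R => z 1 0) Ak.
have e2 := congr1 (fun z : C3 R => z 2%:R 0) Ak.
move: e0 e1 e2; rewrite !col3E !mxE.
have [z20|z2n] := eqVneq (z 2%:R 0) 0.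
  move=> _ _; rewrite z20 mulr0 => /eqP; rewrite oppr_eq0 => /eqP z00.
  move: zz; rewrite /herm z20 z00 rmorph0 !mulr0 add0r addr0 -normCK.
  move/eqP; rewrite expf_eq0 normr_eq0 /= => /eqP z10.
  by case/eqP: z0; rewrite (col3_eta z) z20 z00 z10; apply: col3_ext; rewrite !col3E mxE.
have : exists x y, z = z 2%:R 0 *: col3 x y 1.
  exists (z 0 0 / z 2%:R 0), (z 1 0 / z 2%:R 0).
  by rewrite col3Z mulr1 !(mulrC (z 2%:R 0)) !mulfVK// -col3_eta.
move: (z 2%:R 0) z2n => t t0 [x [y zE]].
move=> e0 e1 e2; move: zz e0 e1 e2; rewrite {1 2}zE hermZl hermZr zE !(col3E, mxE).
rewrite herm_col3 rmorph1 !mulr1 mul1r.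
move=> /eqP; rewrite !mulf_eq0 conjC_eq0 (negbTE t0) /= => /eqP zz e0 e1 e2.
have xk : x = - k.
  by apply: (mulfI t0); rewrite mulrN [t * k]mulrC -e2 opprK.
have {e2 e1} ky : (k + 1) * y = - (2 * a^* * k).
  apply: (mulfI t0); apply/eqP; rewrite -subr_eq0; apply/eqP.
  have -> : t * ((k + 1) * y) - t * - (2 * a^* * k) = k * (t * y) -
    (- (t * y) + 2 * (t * - k) * a^*) by ring.
  by rewrite -xk e1 subrr.
have {}e0 : -1 - 2 * a * y - 2 * (a * a^*) * k = - k ^+ 2.
  apply: (mulfI t0); apply/eqP; rewrite -subr_eq0; apply/eqP.
  have -> : t * (-1 - 2 * a * y - 2 * (a * a^*) * k) - t * - k ^+ 2 =
    - t + 2 * a * (- (t * y) + t * - k * a^*) - k * (t * - k) by ring.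
  by rewrite -xk e0 subrr.
have yy : y * y^* = k + k^*.
  by move/eqP: zz; rewrite xk rmorphN /= addrAC -opprD addrC subr_eq0 => /eqP.
(* If [k = -1] then [a = 0], and the squared modulus of [y] would be -2. *)
have k1 : k + 1 != 0.
  apply/eqP => k1; move/eqP: ky; rewrite k1 mul0r eq_sym oppr_eq0 !mulf_eq0.
  rewrite pnatr_eq0 (negbTE k0) orbF /= conjC_eq0 => /eqP a0.
  have kN : k = -1 by apply/eqP; rewrite -addr_eq0 k1.
  have := mul_conjC_ge0 y; rewrite yy kN rmorphN rmorph1 -opprD oppr_ge0.
  by rewrite (_ : 1 + 1 = 2)// => /(lt_le_trans (ltr0Sn _ 1)); rewrite ltxx.
have kroot : (k - 1) * ((k + 1) ^+ 2 - 2 * (a * a^*) * k) = 0.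
  have -> : (k - 1) * ((k + 1) ^+ 2 - 2 * (a * a^*) * k) =
    (k + 1) * ((-1 - 2 * a * y - 2 * (a * a^*) * k) + k ^+ 2) +
    2 * a * ((k + 1) * y + 2 * a^* * k) by ring.
  by rewrite e0 ky !addNr !mulr0 addr0.
have {}kroot : k = `|k| /\ (k + 1) ^+ 2 = 2 * (a * a^*) * k.
  move/eqP: kroot; rewrite mulf_eq0 !subr_eq0 => /orP[/eqP k1'|/eqP kq].
    rewrite k1' normr1; split=> //; have y_a : y = - a^*.
      apply: (mulfI k1); rewrite ky k1'; ring.
    move: yy; rewrite y_a rmorphN /= conjCK mulrNN k1' rmorph1 mulrC => ->.
    ring.
  split=> //; have n2 : `|k + 1| ^+ 2 = 2 * (a * a^*) * `|k|.
    rewrite -normrX kq -normCK !normrM normr_id ger0_norm//.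
  have aa0 : a * a^* != 0.
    by apply: contra_neq k1 => aa; apply/eqP; rewrite -sqrf_eq0 kq aa mulr0 mul0r.
  (* The squared modulus of [(k + 1) * y] is computed in two ways, from [ky] and from [n2] with
     [yy]. A number whose real part equals its modulus is real and nonnegative. *)
  have k2 : k + k^* = 2 * `|k|.
    apply: (mulIf (_ : 2 * (a * a^*) * `|k| != 0)).
      by apply: mulf_neq0; rewrite ?normr_eq0//; apply: mulf_neq0 => //; rewrite pnatr_eq0.
    rewrite -[in LHS]n2 -yy -normCK -exprMn -normrM mulrC ky normrN -normrX.
    rewrite !normrX !normrM norm_conjC ger0_norm// !exprMn normCK; ring.
  apply/eqP; rewrite -subr_eq0 -normr_eq0 -sqrf_eq0 normCK rmorphB /=.
  rewrite (CrealP (normr_real _)).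
  have -> : (k - `|k|) * (k^* - `|k|) = k * k^* - `|k| * (k + k^*) + `|k| ^+ 2 by ring.
  by rewrite k2 -normCK; apply/eqP; ring.
case: kroot => kn kq.
pose m := complex.Re k.
have km : k = m%:C%C.
  by rewrite RRe_real// kn.
exists m.
  split.
    by rewrite -(ltcR 0) -km kn normr_gt0.
  apply: (@complexI R); rewrite !rmorphM /= -sqnE rmorph_nat.
  by rewrite -expr2 rmorphD rmorph1 /= -km.
rewrite vline_scale//; congr (<[_]>%VS); rewrite xk; apply: col3_ext; rewrite !col3E -?km//.
by apply: (mulfI k1); rewrite ky; field.
Qed.

(** The roots of [m^2 - 2 (sqn a - 1) m + 1] have product 1. No root is positive if [sqn a < 2], 1
    is a double root if [sqn a = 2], and there are two positive roots if [sqn a > 2]. *)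
Lemma ellipticP : elliptic (\pi_(PU21 R) A) <-> sqn a < 2.
Proof.
rewrite /elliptic /parabolic /loxodromic bd_fixedE; split; last first.
  move=> a2; have -> : eigenvalues = set0.
    apply/seteqP; split=> m //= [m0 e].
    have : sqn a * m < 2 * m by rewrite ltr_pM2r.
    have := sqr_ge0 (m - 1); nra.
  rewrite image_set0; split; rewrite card_eq_sym card_eq0 => /eqP e;
    by have : set0 0%N by rewrite -e.
move=> [np nl]; rewrite ltNge; apply/negP => l2.
have [l_eq2|l_neq2] := eqVneq (sqn a) 2.
  apply: np; rewrite (_ : eigenvalues = [set 1]) ?image_set1 ?card_set1//.
  apply/seteqP; split=> m /=; rewrite /eigenvalues /= l_eq2; last first.
    by move=> ->; split=> //; ring.
  move=> [_ e]; apply/eqP; rewrite -subr_eq0 -sqrf_eq0; apply/eqP.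
  rewrite (_ : (m - 1) ^+ 2 = (m + 1) ^+ 2 - 4 * m); last by ring.
  by rewrite e; ring.
have l_gt2 : 2 < sqn a by rewrite lt_def l_neq2.
set s := Num.sqrt ((sqn a - 1) ^+ 2 - 1).
have s2 : s ^+ 2 = (sqn a - 1) ^+ 2 - 1 by rewrite sqr_sqrtr//; nra.
have s0 : 0 < s by rewrite sqrtr_gt0; nra.
have s_lt : s < sqn a - 1.
  by rewrite -(@ltr_pXn2r _ 2) ?nnegrE ?s2 ?gtrBl ?ltr01 ?(ltW s0)//; lra.
have eq2 : eigenvalues = [set sqn a - 1 + s; sqn a - 1 - s].
  apply/seteqP; split=> m /=; rewrite /eigenvalues /=.
    move=> [_ e]; have /eqP : (m - (sqn a - 1 + s)) * (m - (sqn a - 1 - s)) = 0.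
      rewrite (_ : _ * _ = (m - (sqn a - 1)) ^+ 2 - s ^+ 2); last by ring.
      by rewrite s2; nra.
    by rewrite mulf_eq0 !subr_eq0 => /orP[]/eqP ->; [left|right].
  by case=> ->; split; nra.
apply: nl; rewrite eq2 image_setU !image_set1; apply: card_eq_set2.
move=> /vline_eq /(_ (fixed_vector_neq0 _))[k _ e].
have := congr1 (fun z : C3 R => z 2%:R 0) e.
have := congr1 (fun z : C3 R => z 0 0) e.
rewrite col3Z !col3E mulr1 => e1 k1; move: e1; rewrite -k1 mul1r.
by move=> /oppr_inj /complexI; lra.
Qed.
End TwoReflections.

(** * The topology of PU(2,1) *)

Section Topology.
Context {R : realType}.
Implicit Types A B : U21 R.

Definition entry_close (e : R[i]) A B :=
  forall i j, `|U21val A i j - U21val B i j| < e.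

Lemma PU21_nbhs_close A (V : set (PU21 R)) : nbhs (\pi_(PU21 R) A) V ->
  exists2 e : R[i], 0 < e & forall B, entry_close e A B -> V (\pi_(PU21 R) B).
Proof.
move=> /(@pi_continuous _ {eq_quot (@proj_equiv R)} A).
rewrite nbhsE => -[W [[W' oW' <-] WA] WV].
have : nbhs (U21val A) W' by apply: open_nbhs_nbhs; split.
move=> /nbhs_ballP[e e0 eW]; exists e => // B AB.
by apply: WV; apply: eW; split.
Qed.

Lemma PU21_open_close (O : set (PU21 R)) :
  (forall A, O (\pi_(PU21 R) A) -> exists2 e : R[i], 0 < e &
    forall B, entry_close e A B -> O (\pi_(PU21 R) B)) -> open O.
Proof.
move=> hO; rewrite /open /= /quotient_open openE => A OA; rewrite /interior nbhsE.
have [e e0 eO] := hO A OA.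
pose W : set 'M[R[i]]_3 := ball (U21val A) e.
have AW : nbhs (U21val A) W by apply/nbhs_ballP; exists e.
have [W' [oW' W'A W'W]] : exists W', [/\ open W', W' (U21val A) & W' `<=` W].
  by move: AW; rewrite nbhsE => -[W' [oW' W'A] W'W]; exists W'.
exists ((fun B : U21 R => U21val B) @^-1` W'); first by split => //; exists W'.
by move=> B /= /W'W [_ AB]; apply: eO.
Qed.

End Topology.

(** * Powers of a unit complex number that return near 1 *)

Section Recurrence.
Context {R : realType}.

Lemma truncn_close (n : nat) (x y : R) : (0 < n)%N -> -1 <= x -> -1 <= y ->
  Num.truncn ((x + 1) * n%:R) = Num.truncn ((y + 1) * n%:R) ->
  (x - y) ^+ 2 <= n%:R^-1 ^+ 2.
Proof.
move=> n0 x1 y1 e; have N0 : 0 < n%:R :> R by rewrite ltr0n.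
have itv (z : R) : -1 <= z -> (Num.truncn ((z + 1) * n%:R))%:R <= (z + 1) * n%:R <
    (Num.truncn ((z + 1) * n%:R)).+1%:R.
  by move=> z1; apply: Num.Theory.truncn_itv; apply: mulr_ge0; [lra|exact: ltW].
have /andP[xa xb] := itv x x1; have /andP[ya yb] := itv y y1.
move: xa xb ya yb; rewrite -e -natr1 => xa xb ya yb.
rewrite -ler_sqrt ?exprn_gt0 ?invr_gt0// !sqrtr_sqr [leRHS]gtr0_norm ?invr_gt0//.
by rewrite -[leRHS]mul1r ler_pdivlMr// -{1}[n%:R]gtr0_norm// -normrM ler_norml; lra.
Qed.

(** Pigeonhole: two powers of [l] share a cell of side [1/n] in the square of points with
    coordinates in [[-1, 1]], and their quotient is as close to 1 as they are to each other. *)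
Lemma unit_power_recurrent (l : R[i]) (e : R) : `|l| = 1 -> 0 < e ->
  exists2 k : nat, (0 < k)%N & `|l ^+ k - 1| < e%:C%C.
Proof.
move=> l1 e0.
have [n [n0 ne]] : exists n : nat, (0 < n)%N /\ 2 / n%:R < e.
  exists (Num.truncn (2 / e)).+1; split=> //.
  rewrite ltr_pdivrMr// mulrC -ltr_pdivrMr//.
  by have /andP[] := Num.Theory.truncn_itv (divr_ge0 (ler0n R 2) (ltW e0)).
have bnd k : -1 <= complex.Re (l ^+ k) <= 1 /\ -1 <= complex.Im (l ^+ k) <= 1.
  have : complex.Re (l ^+ k) ^+ 2 + complex.Im (l ^+ k) ^+ 2 = 1.
    by apply: (@complexI R); rewrite add_Re2_Im2 normrX l1 !expr1n.
  by move=> h; split; nra.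
(* The end point [x = 1] falls in cell [2 * n], hence one more than [2 * n] cells. *)
pose cell x : 'I_(2 * n).+1 := inord (Num.truncn ((x + 1) * n%:R : R)).
have cellE x : -1 <= x <= 1 -> cell x = Num.truncn ((x + 1) * n%:R : R) :> nat.
  move=> /andP[x1 x2]; rewrite inordK// ltnS -(@ler_nat R).
  have N0 : 0 < n%:R :> R by rewrite ltr0n.
  have xn : 0 <= (x + 1) * n%:R by apply: mulr_ge0; [lra|exact: ltW].
  have /andP[+ _] := Num.Theory.truncn_itv xn.
  by move=> /le_trans; apply; rewrite natrM ler_pM2r//; lra.
have [N cardN] : exists N, #|{: 'I_(2 * n).+1 * 'I_(2 * n).+1}| = N by eexists.
pose f (k : 'I_N.+1) :=
  (cell (complex.Re (l ^+ k)), cell (complex.Im (l ^+ k))).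
have /injectivePn[i [j ij fij]] : ~~ injectiveb f.
  by apply/negP => /injectiveP /leq_card; rewrite card_ord cardN ltnn.
wlog ltij : i j ij fij / (i < j)%N.
  move=> W; case: (ltngtP i j) => [||/val_inj eij]; first exact: W.
    by apply: W => //; rewrite eq_sym.
  by rewrite eij eqxx in ij.
exists (j - i)%N; first by rewrite subn_gt0.
have -> : `|l ^+ (j - i) - 1| = `|l ^+ i - l ^+ j|.
  have li : `|l ^+ i| = 1 by rewrite normrX l1 expr1n.
  transitivity `|l ^+ i * (l ^+ (j - i) - 1)|; first by rewrite normrM li mul1r.
  by rewrite mulrBr mulr1 -exprD (subnKC (ltnW ltij)) distrC.
case: fij => /(congr1 val) + /(congr1 val).
have [ri ii] := bnd i; have [rj ij'] := bnd j.
rewrite /= !cellE// => er ei.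
have /andP[ri1 _] := ri; have /andP[rj1 _] := rj.
have /andP[ii1 _] := ii; have /andP[ij1 _] := ij'.
have Hr := truncn_close n0 ri1 rj1 er.
have Hi := truncn_close n0 ii1 ij1 ei.
rewrite normc_def ltcR; apply: le_lt_trans ne.
rewrite -[leRHS]gtr0_norm ?divr_gt0 ?ltr0n// -sqrtr_sqr ler_wsqrtr//.
rewrite !raddfB /= exprMn.
apply: le_trans (lerD Hr Hi) _; have := sqr_ge0 (n%:R^-1 : R); lra.
Qed.

End Recurrence.

(** * Discreteness by ping-pong *)

Section OpenCondition.
Context {R : realType}.
Implicit Types (A B : U21 R) (G : 'M[R[i]]_3) (c z : C3 R).

Lemma norm_gap_open G c (i j : 'I_3) A :
  `|(G *m (U21val A *m c)) i 0| < `|(G *m (U21val A *m c)) j 0| ->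
  exists2 e : R[i], 0 < e & forall B, entry_close e A B ->
    `|(G *m (U21val B *m c)) i 0| < `|(G *m (U21val B *m c)) j 0|.
Proof.
set x := `|_|; set y := `|_| => xy.
(* Summing over all rows gives one bound for both coordinates [i] and [j]; in [e], adding 1 keeps
   the divisor positive. *)
pose S : R[i] := \sum_h \sum_k `|G h k| * \sum_l `|c l 0|.
have S0 : 0 <= S.
  by do 2!apply: sumr_ge0 => ? _; apply: mulr_ge0 => //; apply: sumr_ge0.
have S1 : 0 < S + 1 by rewrite ltr_wpDl.
pose e := (y - x) / (2 * (S + 1)).
have e0 : 0 < e by rewrite divr_gt0 ?subr_gt0// mulr_gt0.
exists e => // B AB.
have dist h : `|(G *m (U21val A *m c)) h 0 - (G *m (U21val B *m c)) h 0| <= e * S.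
  have -> : (G *m (U21val A *m c)) h 0 - (G *m (U21val B *m c)) h 0 =
    \sum_k G h k * \sum_l (U21val A k l - U21val B k l) * c l 0.
    rewrite !mxE -sumrB; apply: eq_bigr => k _; rewrite !mxE -mulrBr -sumrB.
    by congr (_ * _); apply: eq_bigr => l _; rewrite mulrBl.
  apply: (@le_trans _ _ (e * \sum_k `|G h k| * \sum_l `|c l 0|)); last first.
    rewrite ler_pM2l// /S [leRHS](bigD1 h)//= lerDl.
    by do 2!apply: sumr_ge0 => ? _; apply: mulr_ge0 => //; apply: sumr_ge0.
  rewrite mulr_sumr; apply: le_trans (ler_norm_sum _ _ _) _.
  apply: ler_sum => k _; rewrite normrM mulrCA ler_wpM2l// mulr_sumr.
  apply: le_trans (ler_norm_sum _ _ _) _; apply: ler_sum => l _.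
  by rewrite normrM ler_wpM2r// ltW.
have eS : e * S + e * S < y - x.
  rewrite -mulr2n -[_ *+ 2]mulr_natl /e mulrCA mulrAC -mulrA mulrA.
  rewrite [X in X < _](_ : _ = (y - x) * (S / (S + 1))); last first.
    by field; rewrite lt0r_neq0.
  by rewrite gtr_pMr ?subr_gt0// ltr_pdivrMr// mul1r ltrDl.
have Bi : `|(G *m (U21val B *m c)) i 0| <= x + e * S.
  rewrite -lerBlDl; apply: le_trans (dist i).
  by rewrite distrC; apply: lerB_dist.
have Bj : y - e * S <= `|(G *m (U21val B *m c)) j 0|.
  rewrite lerBlDr -lerBlDl; apply: le_trans (dist j).
  exact: lerB_dist.
by apply: le_lt_trans Bi _; apply: lt_le_trans Bj; rewrite ltrBrDr -addrA -ltrBrDl.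
Qed.

(* This condition holds for 1 and is open and scale-invariant, while ping-pong
   refutes it for the matrix of every nontrivial word; hence 1 is isolated. *)
Definition separating (B : 'M[R[i]]_3) : Prop :=
  `|(B *m infty) 2%:R 0| < `|(B *m infty) 0 0| /\
  `|(B *m origin) 0 0| < `|(B *m origin) 2%:R 0|.

Lemma separating_scale (k : R[i]) (B : 'M[R[i]]_3) : k != 0 ->
  separating (k *: B) <-> separating B.
Proof.
move=> k0; rewrite /separating -!scalemxAl !mxE !normrM.
by rewrite !ltr_pM2l ?normr_gt0.
Qed.

Lemma separating1 : separating 1%:M.
Proof.
by rewrite /separating !mul1mx !col3E normr1 normr0 ltr01.
Qed.

(** The left factor [G] moves the condition from 1 to any other element, in place of continuity of
    left translation on the quotient. The representative chosen by [repr] is harmless, as the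
    condition is scale-invariant. *)
Lemma separating_open G :
  open [set h : PU21 R | separating (G *m U21val (repr h))].
Proof.
have scale A : separating (G *m U21val (repr (\pi_(PU21 R) A))) <->
    separating (G *m U21val A).
  have [k k0 ->] := PU21_reprP A.
  by rewrite -scalemxAr separating_scale.
apply: PU21_open_close => A /= /scale; rewrite /separating -!mulmxA => -[U V].
have [e e0 eP] := norm_gap_open U; have [d d0 dP] := norm_gap_open V.
have ed : e >=< d by apply: real_comparable; rewrite realE ltW.
exists (Order.min e d) => [|B AB]; first by rewrite comparable_lt_min// e0.
apply/scale; rewrite /separating -!mulmxA; split.
  by apply: eP => i j; have := AB i j; rewrite comparable_lt_min// => /andP[].
by apply: dP => i j; have := AB i j; rewrite comparable_lt_min// => /andP[].
Qed.

End OpenCondition.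

Section Representation.
Context {R : realType}.
Variables a1 a2 : R[i].
Variable phi : {multiplicative Gamma -> PU21 R}.
Hypothesis phiE : forall j, phi (gen j) = creflection (tri a1 a2 j).
Implicit Types u v : Gamma.

Lemma phi1 : phi 1%g = 1%g.
Proof. by apply: (@mulgI _ (phi 1%g)); rewrite -gmulfM !mulg1. Qed.

Lemma phi_word u : exists2 A : U21 R, phi u = \pi_(PU21 R) A &
  forall z, U21val A *m z = wact a1 a2 u z.
Proof.
case: u => w rw; elim: w rw => [|j w IHw] rw.
  exists 1%g; last by move=> z; rewrite mul1mx.
  by rewrite (_ : MkGamma rw = 1%g) ?phi1//; exact: val_inj.
have rw' : reduced w := path_sorted rw.
have -> : MkGamma rw = (gen j * MkGamma rw')%g.
  by apply: val_inj; rewrite /= wpush_cons.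
have [A phiA AE] := IHw rw'.
exists (MkU21 (refl_mx_U21 (tri a1 a2 j)) * A)%g.
  by rewrite gmulfM phiE phiA /creflection; exact: PU21_piM.
move=> z; rewrite [gword _](wpush_cons rw) wact_cons -AE -refl_mxE.
by rewrite mulmxA.
Qed.

Section Discreteness.
Hypothesis far : forall k, 2 <= `|center a1 a2 k| ^+ 2.
Hypothesis trans_far :
  4 <= `|a2 - a1| ^+ 4 - (a2 * a1^* - a1 * a2^*) ^+ 2.

Lemma separating_eq1 u A : phi u = \pi_(PU21 R) A -> separating (U21val A) -> u = 1%g.
Proof.
have [B -> BE] := phi_word u => /eqP /PU21_eqP[k k0 BA].
rewrite -(separating_scale _ k0) -BA => -[]; rewrite !BE => U V.
apply: val_inj; apply: contrapT => u0.
exact: (pingpong far trans_far (gwordP u) u0 (conj U V)).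
Qed.

Lemma faithful_of_far : faithful_rep phi.
Proof.
move=> u v uv; have : (u^-1 * v)%g = 1%g.
  apply: (@separating_eq1 _ 1%g); last exact: separating1.
  apply: (@mulgI _ (phi u)); rewrite -gmulfM mulgA mulgV mul1g -uv.
  by rewrite -[RHS]/(phi u * 1)%g mulg1.
by move=> e; rewrite -[v]mul1g -(mulgV u) -mulgA e mulg1.
Qed.

Lemma discrete_of_far : discrete_rep phi.
Proof.
move=> _ [u _ <-]; split; first by rewrite inE; exists u.
have [G phiG _] := phi_word u^-1%g.
(* With [G] representing [phi u^-1], an element [phi v] of the neighbourhood makes [u^-1 * v]
   separating, hence trivial. *)
have Gu : separating (U21val G *m U21val (repr (phi u))).
  have e : (\pi_(PU21 R) (G * repr (phi u))%g = 1)%g.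
    rewrite -PU21_piM -phiG reprK -[LHS]/(phi u^-1%g * phi u)%g.
    by rewrite -gmulfM mulVg phi1.
  move: e => /eqP /PU21_eqP[k k0 /= ->].
  by rewrite separating_scale//; exact: separating1.
exists [set h : PU21 R | separating (U21val G *m U21val (repr h))].
  by apply: open_nbhs_nbhs; split; first exact: separating_open.
apply/seteqP; split=> [h [/= s [v _ vh]]|_ ->]; last by split=> //; exists u.
rewrite /= -vh; rewrite -vh in s; suff -> : v = u by [].
have e : (u^-1 * v)%g = 1%g.
  apply: (@separating_eq1 _ (G * repr (phi v))%g) => //.
  by rewrite gmulfM phiG -PU21_piM reprK.
by rewrite -[v]mul1g -(mulgV u) -mulgA e mulg1.
Qed.

End Discreteness.

End Representation.

(** * The elliptic case *)

Section InfiniteOrder.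
Implicit Types v : Gamma.

Lemma gen_head (j : 'I_3) v : ohead v <> Some j -> gword (gen j * v)%g = j :: v.
Proof. by case: v => [[|k w] rw] //= kj; case: eqVneq => // jk; rewrite jk in kj. Qed.

Definition test_word (n : nat) : Gamma :=
  (gen 0 * (gen 1%R * gen 0) ^+ n * gen 2%:R)%g.

(** The last letter of the test word is 2, so nothing cancels against [v]. All positive powers of
    the test word therefore begin with the letter 0 and are nontrivial. *)
Lemma test_word_head n v : (ohead v = None \/ ohead v = Some 0) ->
  ohead (test_word n * v)%g = Some 0.
Proof.
move=> hv; rewrite /test_word -!mulgA gen_head//.
suff : ohead ((gen 1%R * gen 0) ^+ n * (gen 2%:R * v))%g = Some 1 \/
       ohead ((gen 1%R * gen 0) ^+ n * (gen 2%:R * v))%g = Some 2%:R.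
  by case=> ->.
elim: n => [|n IHn].
  by right; rewrite expg0 mul1g gen_head//; case: hv => ->.
left; rewrite expgS -!mulgA; set x : Gamma := (_ ^+ n * _)%g in IHn *.
have h0 : gword (gen 0 * x)%g = 0 :: x by rewrite gen_head//; case: IHn => ->.
by rewrite (@gen_head 1) ?h0.
Qed.

Lemma test_word_infinite n k : (0 < k)%N -> (test_word n ^+ k)%g <> 1%g.
Proof.
case: k => // k _ e.
have : ohead (test_word n ^+ k.+1)%g = Some 0; last by rewrite e.
elim: k {e} => [|k IHk]; rewrite expgS; apply: test_word_head; first by left.
by right.
Qed.

End InfiniteOrder.

(* The vectors u and v are the Lagrange projections of z to the eigenspaces of l
   and m of an operator annihilated by (T - l) (T - m) (T - 1). *)
Lemma eigen_split (F : fieldType) (V : lmodType F) (f : {linear V -> V})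
    (l m : F) (z : V) (q := f z - z) : l * m = 1 -> l != 1 -> m != 1 -> l != m ->
  f (f q) = (l + m) *: f q - q ->
  exists u v, [/\ f u = l *: u, f v = m *: v & f (z - u - v) = z - u - v].
Proof.
move=> lm l1 m1 lm' fq.
have d1 : l - 1 != 0 by rewrite subr_eq0.
have d2 : m - 1 != 0 by rewrite subr_eq0.
have d3 : l - m != 0 by rewrite subr_eq0.
have d4 : m - l != 0 by rewrite -opprB oppr_eq0.
pose u := ((l - 1) * (l - m))^-1 *: (f q - m *: q).
pose v := ((m - 1) * (m - l))^-1 *: (f q - l *: q).
have fu : f u = l *: u.
  rewrite /u linearZ linearB linearZ /= fq [RHS]scalerA [l * _]mulrC -[RHS]scalerA; congr (_ *: _).
  by rewrite scalerDl addrAC addrK scalerBr scalerA lm scale1r.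
have fv : f v = m *: v.
  rewrite /v linearZ linearB linearZ /= fq [RHS]scalerA [m * _]mulrC -[RHS]scalerA; congr (_ *: _).
  by rewrite (addrC l) scalerDl addrAC addrK scalerBr scalerA (mulrC m) lm scale1r.
exists u, v; split=> //; rewrite !linearB /= fu fv.
have uv : (l - 1) *: u + (m - 1) *: v = f z - z.
  rewrite /u /v !scalerA.
  have -> : (l - 1) * ((l - 1) * (l - m))^-1 = (l - m)^-1 by field; rewrite d1 d3.
  have -> : (m - 1) * ((m - 1) * (m - l))^-1 = - (l - m)^-1.
    by field; rewrite d2 d3 d4.
  have cancel (p a b : V) : p - a - (p - b) = b - a.
    by rewrite opprB addrC addrA subrK.
  rewrite scaleNr -scalerBr cancel -scalerBl scalerA mulVf//.
  by rewrite scale1r.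
apply/eqP; rewrite !subr_eq -(subrK z (f z)) -uv !scalerBl !scale1r.
move: (l *: u) (m *: v) => x y; rewrite addrC -!addrA; apply/eqP; congr (_ + _).
by rewrite addrC -!addrA; congr (_ + _); rewrite addrCA.
Qed.

(** This covers the centre [a = 0], where both eigenvalues other than 1 equal -1 and [eigen_split]
    would divide by zero. *)
Lemma involution_split (F : numFieldType) (V : lmodType F) (f : {linear V -> V})
    (z : V) : f (f z) = z -> exists2 u, f u = (-1) *: u & f (z - u) = z - u.
Proof.
move=> ffz; pose u := 2^-1 *: (z - f z).
have fu : f u = (-1) *: u by rewrite scaleN1r /u linearZ linearB /= ffz -scalerN opprB.
have uu : u + u = z - f z.
  by rewrite -scalerDl (_ : 2^-1 + 2^-1 = 1) ?scale1r//; field.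
exists u => //; rewrite linearB /= fu scaleN1r opprK; apply: (addIr u).
by rewrite subrK -addrA uu addrC subrK.
Qed.

Section EllipticRecurrence.
Context {R : realType}.
Implicit Types (z : C3 R) (l : R[i]) (M : 'M[R[i]]_3) (A : U21 R).

Lemma eigen_power A (u : C3 R) (l : R[i]) k : U21val A *m u = l *: u ->
  U21val (A ^+ k)%g *m u = l ^+ k *: u.
Proof.
move=> Au; elim: k => [|k IHk]; first by rewrite expg0 /= mul1mx expr0 scale1r.
by rewrite expgS /= -mulmxA IHk -scalemxAr Au scalerA -exprSr.
Qed.

Lemma refl2_split (a : R[i]) A :
  (forall z, U21val A *m z = refl (vert a) (refl unit3 z)) -> sqn a < 2 ->
  exists2 l : R[i], `|l| = 1 & forall z, exists u v,
    [/\ U21val A *m u = l *: u, U21val A *m v = l^* *: v &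
        U21val A *m (z - u - v) = z - u - v].
Proof.
move=> AE a2; have [a0|a0] := eqVneq a 0.
  exists (-1); first by rewrite normrN1.
  move=> z; have AA : U21val A *m (U21val A *m z) = z.
    rewrite !(refl2E AE) a0 rmorph0 !col3E.
    by apply: col3_ext; rewrite col3E; ring.
  have [u fu fz] := @involution_split _ _ (mulmx (U21val A)) z AA.
  by exists u, 0; rewrite mulmx0 scaler0 subr0.
have l_gt0 : 0 < sqn a.
  by rewrite -(ltcR 0) -sqnE -normCK exprn_gt0// normr_gt0.
pose s := Num.sqrt (1 - (sqn a - 1) ^+ 2).
have s2 : s ^+ 2 = 1 - (sqn a - 1) ^+ 2 by rewrite sqr_sqrtr//; nra.
have s0 : 0 < s by rewrite sqrtr_gt0; nra.
(* A root of the quadratic of [eigenvalues], now with negative discriminant; the other root is its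
   conjugate, and their product is 1. *)
pose l : R[i] := ((sqn a - 1) +i* s)%C.
have ls : l + l^* = (2 * sqn a - 2)%:C%C.
  by apply/eqP; rewrite eq_complex /= subrr eqxx andbT; apply/eqP; ring.
have ll : l * l^* = 1.
  rewrite sqnE /sqn /= s2; congr (_ %:C)%C; ring.
have lc : l != l^*.
  by rewrite eq_complex /= negb_and; apply/orP; right; apply/eqP; lra.
exists l.
  by apply/eqP; rewrite -sqrp_eq1// normCK ll.
have ln1 : l != 1.
  by rewrite eq_complex /= negb_and; apply/orP; right; rewrite gt_eqF.
move=> z; apply: (@eigen_split _ _ (mulmx (U21val A))) => //.
  by apply: contra_neq ln1 => h; rewrite -[l]conjCK h rmorph1.
rewrite ls (_ : (2 * sqn a - 2)%:C%C = 2 * (a * a^*) - 2); last first.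
  by rewrite sqnE !rmorphB rmorphM !rmorph_nat.
rewrite /= !(refl2E AE) !(col3E, mxE). 
by apply: col3_ext; rewrite !(col3E, mxE); ring.
Qed.

(** The eigenvalues are 1, [l] and the conjugate of [l], so one estimate of [l ^+ k - 1] controls
    both moving components of each basis vector. *)
Lemma refl2_recurrent (a : R[i]) A (e : R[i]) :
  (forall z, U21val A *m z = refl (vert a) (refl unit3 z)) -> sqn a < 2 ->
  0 < e -> exists2 k, (0 < k)%N & entry_close e 1%g (A ^+ k)%g.
Proof.
move=> AE a2 e0; have [l l1 split3] := refl2_split AE a2.
have /choice[uv uvP] : forall j : 'I_3, exists uv : C3 R * C3 R,
    [/\ U21val A *m uv.1 = l *: uv.1, U21val A *m uv.2 = l^* *: uv.2 &
       U21val A *m (delta_mx j 0 - uv.1 - uv.2) = delta_mx j 0 - uv.1 - uv.2].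
  by move=> j; have [u [v uvP]] := split3 (delta_mx j 0); exists (u, v).
pose S : R[i] := \sum_j \sum_i (`|(uv j).1 i 0| + `|(uv j).2 i 0|).
have S0 : 0 <= S by do 2!apply: sumr_ge0 => ? _; rewrite addr_ge0.
have S1 : 0 < S + 1 by rewrite ltr_wpDl.
have eS : 0 < e / (S + 1) by rewrite divr_gt0.
pose d := complex.Re (e / (S + 1)).
have dE : d%:C%C = e / (S + 1) by rewrite RRe_real// gtr0_real.
have d0 : 0 < d by rewrite -(ltcR 0) dE.
have [k k0 kd] := unit_power_recurrent l1 d0.
exists k => // i j.
have -> : U21val 1%g i j = (delta_mx j 0 : C3 R) i 0 by rewrite !mxE andbT.
have -> : U21val (A ^+ k)%g i j = (U21val (A ^+ k)%g *m delta_mx j 0 : C3 R) i 0.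
  rewrite mxE (bigD1 j)//= !mxE eqxx mulr1 big1 ?addr0// => h hj.
  by rewrite mxE (negbTE hj) mulr0.
have [Au Av Aw] := uvP j; set u := (uv j).1 in Au Aw *; set v := (uv j).2 in Av Aw *.
have dz : (delta_mx j 0 : C3 R) = (delta_mx j 0 - u - v) + u + v.
  by rewrite -addrA addrC addrA; apply/matrixP => x y; rewrite !mxE; ring.
have Aw1 : U21val A *m (delta_mx j 0 - u - v) = 1 *: (delta_mx j 0 - u - v).
  by rewrite scale1r.
have -> : U21val (A ^+ k)%g *m delta_mx j 0 =
    delta_mx j 0 - u - v + l ^+ k *: u + (l ^+ k)^* *: v.
  rewrite [in LHS]dz 2!mulmxDr (eigen_power k Aw1) (eigen_power k Au).
  by rewrite (eigen_power k Av) expr1n scale1r rmorphXn.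
rewrite !mxE; set dj := (_ && _)%:R.
rewrite (_ : dj - _ = - ((l ^+ k - 1) * u i 0 + (l ^+ k - 1)^* * v i 0)); last first.
  by rewrite rmorphB rmorph1; ring.
rewrite normrN; apply: le_lt_trans (ler_normD _ _) _.
rewrite !normrM norm_conjC -mulrDr.
apply: (@le_lt_trans _ _ (d%:C%C * S)).
  apply: ler_pM; [exact: normr_ge0|exact: addr_ge0|exact: ltW|].
  rewrite /S (bigD1 j)//= (bigD1 i)//= -addrA lerDl addr_ge0//.
    by apply: sumr_ge0 => ? _; rewrite addr_ge0.
  by do 2!apply: sumr_ge0 => ? _; rewrite addr_ge0.
by rewrite dE mulrAC ltr_pdivrMr// ltr_pM2l// ltrDl.
Qed.

End EllipticRecurrence.

Section EllipticCase.
Context {R : realType}.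
Variables a1 a2 : R[i].
Variable phi : {multiplicative Gamma -> PU21 R}.
Hypothesis phiE : forall j, phi (gen j) = creflection (tri a1 a2 j).
Variable n : nat.

Let M j : U21 R := MkU21 (refl_mx_U21 (tri a1 a2 j)).
Let A : U21 R := (M 0 * (M 1%R * M 0) ^+ n * M 2%:R)%g.

Lemma phi_test_word : phi (test_word n) = \pi_(PU21 R) A.
Proof.
have piM (B D : U21 R) :
  (\pi_(PU21 R) B * \pi_(PU21 R) D)%g = \pi_(PU21 R) (B * D)%g := PU21_piM B D.
have cr j : creflection (tri a1 a2 j) = \pi_(PU21 R) (M j) by [].
rewrite /test_word /A !gmulfM !phiE.
have -> : phi ((gen 1%R * gen 0) ^+ n)%g = \pi_(PU21 R) ((M 1%R * M 0) ^+ n)%g.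
  elim: n => [|m IHm]; first by rewrite !expg0 phi1.
  rewrite !expgS gmulfM IHm gmulfM !phiE.
  by rewrite !cr (piM (M 1%R) (M 0)) piM.
by rewrite !cr (piM (M 0)) piM.
Qed.

Lemma test_matrixE z :
  U21val A *m z = refl (vert (center a1 a2 (- n%:Z))) (refl unit3 z).
Proof.
rewrite /= -!mulmxA refl_mxE -center_power refl_mxE.
rewrite -[tri a1 a2 2%:R]/unit3 -[tri a1 a2 0]/(vert a1) center0; congr (refl _ _).
elim: n (refl _ _) => [|m IHm] y; first by rewrite expg0 /= mul1mx.
rewrite expgS /= -!mulmxA IHm !refl_mxE -[tri a1 a2 1]/(vert a2).
by rewrite center1.
Qed.

Lemma test_word_elliptic :
  elliptic (phi (test_word n)) <-> sqn (center a1 a2 (- n%:Z)) < 2.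
Proof. by rewrite phi_test_word; apply: ellipticP; exact: test_matrixE. Qed.

(** Finite and infinite order are treated together: discreteness makes a power close to 1 equal to
    1, and then faithfulness contradicts the infinite order of the test word in [Gamma]. *)
Lemma elliptic_not_discrete_faithful : elliptic (phi (test_word n)) ->
  ~ (discrete_rep phi /\ faithful_rep phi).
Proof.
move=> /test_word_elliptic lt2 [disc faith].
have [_ [V V1 VE]] : isolated (range phi) (phi 1%g) by apply: disc; exists 1%g.
rewrite phi1 in V1; have [e e0 eV] := PU21_nbhs_close V1.
have [k k0 kc] := refl2_recurrent test_matrixE lt2 e0.
have phik : phi (test_word n ^+ k)%g = \pi_(PU21 R) (A ^+ k)%g.
  elim: k {k0 kc} => [|k IHk]; first by rewrite !expg0 phi1.
  by rewrite !expgS gmulfM IHk phi_test_word; exact: PU21_piM.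
have /faith : phi (test_word n ^+ k)%g = phi 1%g.
  have : [set phi 1%g] (phi (test_word n ^+ k)%g) => //.
  by rewrite -VE; split; [rewrite phik; exact: eV|exists (test_word n ^+ k)%g].
exact: test_word_infinite.
Qed.

End EllipticCase.

(** * Distances between mirrors *)

Section HyperbolicFunctions.
Context {R : realType}.
Implicit Types t x y : R.

Lemma cosh2_sinh2 t : cosh t ^+ 2 - 1 = sinh t ^+ 2.
Proof.
have := expRxMexpNx_1 t; rewrite /cosh /sinh.
move: (expR t) (expR (- t)) => a b ab.
have -> : ((a + b) / 2) ^+ 2 - 1 = ((a - b) / 2) ^+ 2 + (a * b - 1) by field.
by rewrite ab subrr addr0.
Qed.

Lemma sinh_gt0 t : 0 < t -> 0 < sinh t.
Proof.
by move=> t0; rewrite /sinh divr_gt0// subr_gt0 ltr_expR; lra.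
Qed.

Lemma sinh_ge0 t : 0 <= t -> 0 <= sinh t.
Proof.
by move=> t0; rewrite /sinh divr_ge0// subr_ge0 ler_expR; lra.
Qed.

Lemma cosh_gt0 t : 0 < cosh t.
Proof. by rewrite /cosh divr_gt0// addr_gt0// expR_gt0. Qed.

Lemma cosh_ge1 t : 1 <= cosh t.
Proof.
have := cosh_gt0 t; have := cosh2_sinh2 t; have := sqr_ge0 (sinh t); nra.
Qed.

Lemma cosh_gt1 t : 0 < t -> 1 < cosh t.
Proof.
move=> /sinh_gt0; have := cosh_gt0 t; have := cosh2_sinh2 t; nra.
Qed.

Lemma arcosh_cosh t : 0 <= t -> arcosh (cosh t) = t.
Proof.
move=> t0; rewrite /arcosh cosh2_sinh2 sqrtr_sqr ger0_norm ?sinh_ge0//.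
by rewrite (_ : _ + _ = expR t) ?expRK// /cosh /sinh; field.
Qed.

Lemma ler_arcosh x y : 1 <= x -> x <= y -> arcosh x <= arcosh y.
Proof.
move=> x1 xy; have s0 (z : R) : 0 <= Num.sqrt (z ^+ 2 - 1) by exact: sqrtr_ge0.
rewrite /arcosh ler_ln ?posrE; last 2 first.
- by have := s0 x; lra.
- by have := s0 y; lra.
by rewrite lerD// ler_wsqrtr//; nra.
Qed.

Lemma arcosh_ge0 x : 1 <= x -> 0 <= arcosh x.
Proof.
by move=> x1; rewrite ln_ge0//; have := sqrtr_ge0 (x ^+ 2 - 1); lra.
Qed.

End HyperbolicFunctions.

Section MirrorDistance.
Context {R : realType}.
Implicit Types (a x y : R[i]) (z w n : C3 R) (p q : {vspace C3 R}).

Lemma polar_lineE n z : polar_line n <[z]>%VS <-> herm z n = 0.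
Proof.
split=> [|zn w]; first by apply; exact: memv_line.
by move=> /vlineP[k ->]; rewrite hermZl zn mulr0.
Qed.

Lemma hdistE z w : z != 0 -> w != 0 -> hdist <[z]>%VS <[w]>%VS =
  2 * arcosh (Num.sqrt (complex.Re (herm z w * herm w z / (herm z z * herm w w)))).
Proof.
have pick (v : C3 R) : v != 0 -> exists2 k : R[i], k != 0 & vpick <[v]>%VS = k *: v.
  move=> v0; have /vlineP[k vk] := memv_pick <[v]>%VS; exists k => //.
  apply: contra_neq v0 => k0; have : vpick <[v]>%VS == 0 by rewrite vk k0 scale0r.
  by rewrite vpick0 => /eqP v0; apply/eqP; rewrite -memv0 -v0 memv_line.
move=> /pick[k k0 ek] /pick[l l0 el]; rewrite /hdist ek el !hermZl !hermZr.
have kc : k^* != 0 by rewrite conjC_eq0.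
have lc : l^* != 0 by rewrite conjC_eq0.
congr (2 * arcosh (Num.sqrt (complex.Re _))); rewrite !invfM.
rewrite [RHS](_ : _ = (k / k) * (k^* / k^*) * (l / l) * (l^* / l^*) *
  (herm z w * herm w z * ((herm z z)^-1 * (herm w w)^-1))); last first.
  by rewrite !mulfV// !mul1r.
ring.
Qed.

Lemma hdistC p q : hdist p q = hdist q p.
Proof.
rewrite /hdist [herm (vpick p) (vpick q) * _]mulrC.
by rewrite [herm (vpick p) (vpick p) * _]mulrC.
Qed.

Lemma geod_distC (C D : set {vspace C3 R}) : geod_dist C D = geod_dist D C.
Proof.
rewrite /geod_dist; congr inf; apply/seteqP.
by split=> _ [p Cp [q Dq <-]]; exists q => //; exists p => //; exact: hdistC.
Qed.

Lemma negative_neq0 z : herm z z < 0 -> z != 0.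
Proof.
by apply: contraTneq => ->; rewrite -(scale0r 0) hermZl mul0r ltxx.
Qed.

Lemma hdist_negative z w (s t : R) : 0 < s -> 0 < t ->
  herm z z = - s%:C%C -> herm w w = - t%:C%C ->
  hdist <[z]>%VS <[w]>%VS = 2 * arcosh (Num.sqrt (sqn (herm z w) / (s * t))).
Proof.
move=> s0 t0 zz ww; rewrite hdistE; first last.
- by apply: negative_neq0; rewrite ww oppr_lt0 ltcR.
- by apply: negative_neq0; rewrite zz oppr_lt0 ltcR.
rewrite -(herm_conj z w) sqnE zz ww mulrNN -rmorphM -fmorphV -rmorphM.
by [].
Qed.

Definition vert_point a x : C3 R := col3 x (- a^*) 1.
Definition unit3_point y : C3 R := col3 (-1) y 1.

Definition vert_level a x : R := - (2 * complex.Re x + sqn a).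

Lemma herm_vert_point a x :
  herm (vert_point a x) (vert_point a x) = - (vert_level a x)%:C%C.
Proof.
rewrite herm_col3 rmorph1 rmorphN /= conjCK mulrNN /vert_level rmorphN opprK.
rewrite rmorphD rmorphM rmorph_nat /= -sqnE.
have -> : 2 * (complex.Re x)%:C%C = x + x^* by rewrite -addcJ.
ring.
Qed.

Lemma herm_unit3_point y :
  herm (unit3_point y) (unit3_point y) = - (2 - sqn y)%:C%C.
Proof.
rewrite herm_col3 rmorphN rmorph1 rmorphB rmorph_nat /= -sqnE; ring.
Qed.

Lemma mirror_vertP a p : mirror (vert a) p <->
  exists2 x, p = <[vert_point a x]>%VS & 0 < vert_level a x.
Proof.
split=> [[pn [z zz e]]|[x -> x0]]; last first.
  split; first by rewrite polar_lineE herm_col3 rmorph0 rmorph1; ring.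
  exists (vert_point a x) => //.
  by rewrite herm_vert_point oppr_lt0 ltcR.
move: pn; rewrite e polar_lineE => zn.
have z1 : z 1 0 = - (z 2%:R 0 * a^*).
  apply/eqP; rewrite -addr_eq0 -zn (col3_eta z) herm_col3 !col3E rmorph0 rmorph1.
  by apply/eqP; ring.
have z2 : z 2%:R 0 != 0.
  apply: contraTneq zz => z2; rewrite /herm z2 z1 z2 rmorph0 !mul0r oppr0 !mulr0.
  by rewrite mul0r !addr0 ltxx.
have zE : z = z 2%:R 0 *: vert_point a (z 0 0 / z 2%:R 0).
  by rewrite [LHS]col3_eta col3Z z1 mulr1 mulrN mulrCA mulfV// mulr1.
exists (z 0 0 / z 2%:R 0); first by rewrite {1}zE vline_scale.
have := zz; rewrite [in herm z z]zE hermZl hermZr herm_vert_point mulrA -normCK.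
by rewrite mulrN oppr_lt0 pmulr_rgt0 ?exprn_gt0 ?normr_gt0// ltcR.
Qed.

Lemma mirror_unit3P p : mirror unit3 p <->
  exists2 y, p = <[unit3_point y]>%VS & sqn y < 2.
Proof.
have s2 : ((Num.sqrt 2)^-1 : R)%:C%C != 0 :> R[i].
  by rewrite fmorph_eq0 invr_eq0 sqrtr_eq0 -ltNge.
split=> [[pn [z zz e]]|[y -> y2]]; last first.
  split; first by rewrite polar_lineE herm_unit3r !col3E addrC subrr mulr0.
  exists (unit3_point y) => //.
  by rewrite herm_unit3_point oppr_lt0 ltcR subr_gt0.
move: pn; rewrite e polar_lineE herm_unit3r => /eqP; rewrite mulf_eq0 (negbTE s2) /=.
rewrite addr_eq0 => /eqP z0.
have z2 : z 2%:R 0 != 0.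
  apply: contraTneq zz => z2; rewrite /herm z0 z2 oppr0 !mul0r add0r addr0.
  by apply/negP => /lt_geF; rewrite mul_conjC_ge0.
have zE : z = z 2%:R 0 *: unit3_point (z 1 0 / z 2%:R 0).
  by rewrite [LHS]col3_eta col3Z z0 mulr1 mulrN1 mulrCA mulfV// mulr1.
exists (z 1 0 / z 2%:R 0); first by rewrite {1}zE vline_scale.
have := zz; rewrite [in herm z z]zE hermZl hermZr herm_unit3_point mulrA -normCK.
by rewrite mulrN oppr_lt0 pmulr_rgt0 ?exprn_gt0 ?normr_gt0// ltcR subr_gt0.
Qed.

(** If [s], [t] are the levels, the real part of the product is [-(s + t + D) / 2], where [D >= 0]
    is the squared distance between [a] and [b]. The arithmetic-geometric mean inequality then
    suffices, and the imaginary part is dropped. *)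
Lemma vert_pair_level a b x y : 0 < vert_level a x -> 0 < vert_level b y ->
  vert_level a x * vert_level b y <= sqn (herm (vert_point a x) (vert_point b y)).
Proof.
rewrite herm_col3 rmorph1 rmorphN /= conjCK /vert_level /sqn.
case: a b x y => [p q] [p' q'] [u v] [u' v'] /=.
set s := - _; set t := - (_ + (p' ^+ 2 + _)) => s0 t0.
rewrite -[leLHS]addr0 lerD ?sqr_ge0//.
pose D := (p - p') ^+ 2 + (q - q') ^+ 2.
have D0 : 0 <= D by rewrite addr_ge0 ?sqr_ge0.
rewrite (_ : _ ^+ 2 = ((s + t + D) / 2) ^+ 2); last by rewrite /s /t /D; field.
have : 0 <= D * (2 * (s + t) + D) by apply: mulr_ge0 => //; lra.
by have := sqr_ge0 (s - t); nra.
Qed.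

(** The real part of the product is [-(s / 2 + K)], whose square is at least [2 s K], and [2 K]
    exceeds the required factor by half the squared modulus of [a y + 2]. Equality needs [a y = -2],
    [s = 2 K] and a real product. *)
Lemma vert_unit3_level a x y : sqn y < 2 -> 0 < vert_level a x ->
  vert_level a x * (2 - sqn y) * (sqn a / 2) <=
  sqn (herm (vert_point a x) (unit3_point y)).
Proof.
rewrite herm_col3 rmorph1 rmorphN1 /vert_level /sqn.
case: a x y => [p q] [u v] [y1 y2] /=.
set s := - _ => y_lt s0.
rewrite -[leLHS]addr0 lerD ?sqr_ge0//.
pose K := (p ^+ 2 + q ^+ 2) / 2 + 1 + (p * y1 - q * y2).
rewrite [leRHS](_ : _ = (s / 2 + K) ^+ 2); last by rewrite /s /K; field.
have K_ge : (2 - (y1 ^+ 2 + y2 ^+ 2)) * ((p ^+ 2 + q ^+ 2) / 2) <= 2 * K.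
  rewrite -subr_ge0 (_ : _ - _ = ((p * y1 - q * y2 + 2) ^+ 2 +
    (p * y2 + q * y1) ^+ 2) / 2); last by rewrite /K; field.
  by rewrite divr_ge0// addr_ge0 ?sqr_ge0.
rewrite -mulrA; apply: (@le_trans _ _ (s * (2 * K))).
  by rewrite ler_pM2l.
by have := sqr_ge0 (s / 2 - K); nra.
Qed.

(* The imaginary part of the first point makes the product real, and then the
   ratio of the two sides of vert_pair_level tends to 1 as s grows. *)
Lemma vert_pair_aligned a b (s : R) :
  sqn (herm (vert_point a (- (s + sqn a) / 2 -i* complex.Im (a^* * b))%C)
            (vert_point b (- (s + sqn b) / 2)%:C%C)) = (s + sqn (a - b) / 2) ^+ 2.
Proof.
rewrite herm_col3 rmorph1 rmorphN /= conjCK.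
by case: a b => [p q] [p' q']; rewrite /sqn /=; field.
Qed.

Lemma geod_dist_vert a b : a != b -> geod_dist (mirror (vert a)) (mirror (vert b)) = 0.
Proof.
move=> ab; rewrite /geod_dist; set S := [set _ | _ in _ & _ in _].
have S_ge0 : lbound S 0.
  move=> _ [_ /mirror_vertP[x -> x0] [_ /mirror_vertP[y -> y0] <-]].
  rewrite (hdist_negative x0 y0) ?herm_vert_point//.
  rewrite mulr_ge0// arcosh_ge0// -sqrtr1 ler_wsqrtr//.
  by rewrite ler_pdivlMr ?mulr_gt0// mul1r vert_pair_level.
have D0 : 0 < sqn (a - b).
  by rewrite -(ltcR 0) -sqnE -normCK exprn_gt0// normr_gt0 subr_eq0.
have S_small (e : R) : 0 < e -> S e.
  move=> e0; pose h := cosh (e / 2) - 1.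
  have h0 : 0 < h by rewrite subr_gt0 cosh_gt1// divr_gt0.
  (* Chosen so that the aligned points at level [s] have distance exactly [e]. *)
  pose s := sqn (a - b) / (2 * h).
  have s0 : 0 < s by rewrite divr_gt0// mulr_gt0.
  have eqh : cosh (e / 2) = 1 + sqn (a - b) / (2 * s).
    have -> : cosh (e / 2) = 1 + h by rewrite /h addrC subrK.
    by congr (1 + _); rewrite /s; field; rewrite !gt_eqF.
  pose c := complex.Im (a^* * b).
  pose x : R[i] := (- (s + sqn a) / 2 -i* c)%C.
  pose y : R[i] := (- (s + sqn b) / 2)%:C%C.
  have lx : vert_level a x = s by rewrite /vert_level /=; field.
  have ly : vert_level b y = s by rewrite /vert_level /=; field.
  have x0 : 0 < vert_level a x by rewrite lx.
  have y0 : 0 < vert_level b y by rewrite ly.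
  exists <[vert_point a x]>%VS; first by apply/mirror_vertP; exists x.
  exists <[vert_point b y]>%VS; first by apply/mirror_vertP; exists y.
  rewrite (hdist_negative x0 y0) ?herm_vert_point// lx ly.
  rewrite vert_pair_aligned.
  have -> : (s + sqn (a - b) / 2) ^+ 2 / (s * s) = cosh (e / 2) ^+ 2.
    by rewrite eqh; field; rewrite gt_eqF.
  rewrite sqrtr_sqr ger0_norm ?(ltW (cosh_gt0 _))// arcosh_cosh ?divr_ge0 ?ltW//.
  by field.
have S0 : S !=set0 by exists 1; exact: S_small.
apply/eqP; rewrite eq_le lb_le_inf// andbT.
apply/ler_addgt0Pl => e e0; rewrite addr0.
by apply: ge_inf; [exists 0|exact: S_small].
Qed.

Lemma geod_dist_vert_unit3 a m : 0 <= m -> 2 < sqn a -> sqn a = 2 * cosh (m / 2) ^+ 2 ->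
  geod_dist (mirror (vert a)) (mirror unit3) = m.
Proof.
move=> m0 a2 am; rewrite /geod_dist; set S := [set _ | _ in _ & _ in _].
have ch : cosh (m / 2) = Num.sqrt (sqn a / 2).
  by rewrite am [2 * _]mulrC mulfK// sqrtr_sqr ger0_norm// ltW// cosh_gt0.
have mE : m = 2 * arcosh (Num.sqrt (sqn a / 2)).
  by rewrite -ch arcosh_cosh ?divr_ge0//; field.
have S_ge : lbound S m.
  move=> _ [_ /mirror_vertP[x -> x0] [_ /mirror_unit3P[y -> y0] <-]].
  have y0' : 0 < 2 - sqn y by rewrite subr_gt0.
  rewrite (hdist_negative x0 y0') ?herm_vert_point ?herm_unit3_point//.
  rewrite {1}mE ler_pM2l// ler_arcosh//.
    by rewrite -ch cosh_ge1.
  by rewrite ler_wsqrtr// ler_pdivlMr ?mulr_gt0// mulrC vert_unit3_level.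
have Sm : S m.
  (* The equality case of [vert_unit3_level]: [a y = -2] gives [K = sqn a / 2 - 1], and this [x] has
     level [2 K = sqn a - 2]. *)
  pose x : R[i] := (1 - sqn a)%:C%C; pose y : R[i] := - 2 / a.
  have a0 : a != 0.
    by apply: contraTneq a2 => ->; rewrite /sqn /= expr0n addr0 -leNgt.
  have ya : sqn y = 4 / sqn a.
    apply: (@complexI R); rewrite fmorph_div rmorph_nat /= -!sqnE /y.
    by rewrite rmorphM rmorphN fmorphV rmorph_nat /=; field; rewrite conjC_eq0 a0.
  have a_gt0 : 0 < sqn a by lra.
  have y2 : sqn y < 2 by rewrite ya ltr_pdivrMr//; lra.
  have lx : vert_level a x = sqn a - 2 by rewrite /vert_level /=; ring.
  have x0 : 0 < vert_level a x by rewrite lx subr_gt0.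
  have y0' : 0 < 2 - sqn y by rewrite subr_gt0.
  exists <[vert_point a x]>%VS; first by apply/mirror_vertP; exists x.
  exists <[unit3_point y]>%VS; first by apply/mirror_unit3P; exists y.
  rewrite (hdist_negative x0 y0') ?herm_vert_point ?herm_unit3_point//.
  rewrite {1}mE; congr (2 * arcosh (Num.sqrt _)); rewrite lx ya.
  have -> : herm (vert_point a x) (unit3_point y) = (2 - sqn a)%:C%C.
    rewrite herm_col3 rmorph1 rmorphN1 /x /y rmorphM rmorphN fmorphV rmorph_nat /=.
    have -> : - a^* * (- 2 / a^*) = 2 by field; rewrite conjC_eq0.
    by rewrite !rmorphB rmorph1 rmorph_nat /=; ring.
  have -> : sqn (2 - sqn a)%:C%C = (sqn a - 2) ^+ 2.
    by rewrite [LHS]/sqn /=; ring.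
  by field; rewrite !gt_eqF//; lra.
apply/eqP; rewrite eq_le; apply/andP; split; first by apply: ge_inf => //; exists m.
by apply: lb_le_inf => //; exists m.
Qed.

End MirrorDistance.

(** * The triangle of mirrors *)

Section Configuration.
Context {R : realType}.
Implicit Types (a b x y : R[i]) (z n : C3 R).

Lemma I3_cases (j : 'I_3) : [\/ j = 0, j = 1 | j = 2%:R].
Proof.
by case: j => [[|[|[|//]]] hj]; [constructor 1|constructor 2|constructor 3];
  exact: val_inj.
Qed.

Lemma bd_vert_infty a : bd_mirror (vert a) <[infty]>%VS.
Proof.
split; first by rewrite polar_lineE herm_col3 rmorph0 !mul0r mulr0 !addr0.
exists infty; split=> //.
  by apply/eqP => /(congr1 (fun z : C3 R => z 0 0)) /eqP; rewrite col3E mxE oner_eq0.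
by rewrite herm_col3 rmorph0 mulr0 !mul0r !addr0.
Qed.

Lemma vert_disjoint a b : a != b -> mirror (vert a) `&` mirror (vert b) = set0.
Proof.
move=> ab; apply/seteqP; split=> p //= [/mirror_vertP[x -> x0] /mirror_vertP[y e y0]].
have /vline_eq : <[vert_point a x]>%VS = <[vert_point b y]>%VS := e.
have n0 : vert_point a x != 0.
  by apply: negative_neq0; rewrite herm_vert_point oppr_lt0 ltcR.
move=> /(_ n0)[k _ ek].
have := congr1 (fun z : C3 R => z 2%:R 0) ek.
have := congr1 (fun z : C3 R => z 1 0) ek.
rewrite col3Z !col3E mulr1 => + k1; rewrite -k1 mul1r => /oppr_inj.
by move=> /(can_inj conjCK) /eqP; rewrite (negbTE ab).
Qed.

Lemma vert_unit3_disjoint a : 2 < sqn a -> mirror (vert a) `&` mirror unit3 = set0.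
Proof.
move=> a2; apply/seteqP; split=> p //= [/mirror_vertP[x -> x0] /mirror_unit3P[y e y0]].
have /vline_eq : <[vert_point a x]>%VS = <[unit3_point y]>%VS := e.
have n0 : vert_point a x != 0.
  by apply: negative_neq0; rewrite herm_vert_point oppr_lt0 ltcR.
move=> /(_ n0)[k _ ek].
have := congr1 (fun z : C3 R => z 2%:R 0) ek.
have := congr1 (fun z : C3 R => z 0 0) ek.
rewrite col3Z !col3E mulr1 => + k1; rewrite -k1 mul1r => xE.
by move: x0; rewrite /vert_level xE /=; lra.
Qed.

Lemma bd_vert_unit3_disjoint a : 2 < sqn a ->
  bd_mirror (vert a) `&` bd_mirror unit3 = set0.
Proof.
move=> a2; apply/seteqP; split=> p //= [[pa [z [z0 zz pz]]] [pu _]].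
move: pa pu; rewrite pz !polar_lineE => za zu.
have z1 : z 1 0 = - (z 2%:R 0 * a^*).
  apply/eqP; rewrite -addr_eq0 -za (col3_eta z) herm_col3 !col3E rmorph0 rmorph1.
  by apply/eqP; ring.
have z0E : z 0 0 = - z 2%:R 0.
  move/eqP: zu; rewrite herm_unit3r mulf_eq0 fmorph_eq0 invr_eq0 sqrtr_eq0.
  by rewrite leNgt ltr0n /= addr_eq0 => /eqP.
have z20 : z 2%:R 0 != 0.
  apply: contra_neq z0 => z2; rewrite (col3_eta z) z0E z1 z2 mul0r oppr0.
  by apply: col3_ext; rewrite !col3E mxE.
have : z 2%:R 0 * (z 2%:R 0)^* * (a * a^* - 2) = 0.
  by rewrite -zz /herm z1 z0E !(rmorphN, rmorphM) /= conjCK; ring.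
move=> /eqP; rewrite !mulf_eq0 conjC_eq0 (negbTE z20) /= subr_eq0 sqnE.
by rewrite -(rmorph_nat (real_complex R)) => /eqP /complexI e; rewrite e ltxx in a2.
Qed.

Lemma vert_mirror_neq0 a : mirror (vert a) !=set0.
Proof.
exists <[vert_point a (- (1 + sqn a) / 2)%:C%C]>%VS.
apply/mirror_vertP; eexists; first by [].
by rewrite /vert_level /= mulrC mulfVK ?pnatr_eq0//; lra.
Qed.

Lemma unit3_mirror_neq0 : mirror (unit3 : C3 R) !=set0.
Proof.
exists <[unit3_point (0 : R[i])%R]>%VS; apply/mirror_unit3P; exists 0 => //.
by rewrite /sqn /= expr0n addr0 ltr0n.
Qed.

Lemma triangle_config_tri (m1 m2 : R) (m : 'I_3 -> R) (n : 'I_3 -> C3 R) a1 a2 :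
  m 0 = m1 -> m 1 = m2 -> m 2%:R = 0 ->
  n 0 = vert a1 -> n 1 = vert a2 -> n 2%:R = unit3 ->
  a1 != a2 -> 0 <= m2 <= m1 -> 2 < sqn a1 -> 2 < sqn a2 ->
  sqn a1 = 2 * cosh (m2 / 2) ^+ 2 -> sqn a2 = 2 * cosh (m1 / 2) ^+ 2 ->
  triangle_config m n.
Proof.
move=> e0 e1 e2 n0 n1 n2 a12 /andP[m20 m21] A1 A2 r2 r1.
have disj i j : i != j -> mirror (n i) `&` mirror (n j) = set0.
  case: (I3_cases i) => ->; case: (I3_cases j) => -> // _; rewrite ?n0 ?n1 ?n2.
  - exact: vert_disjoint.
  - exact: vert_unit3_disjoint.
  - by apply: vert_disjoint; rewrite eq_sym.
  - exact: vert_unit3_disjoint.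
  - by rewrite setIC; exact: vert_unit3_disjoint.
  - by rewrite setIC; exact: vert_unit3_disjoint.
split.
- move=> j; case: (I3_cases j) => ->; rewrite ?n0 ?n1 ?n2 ?herm_vert ?herm_unit3 ltr01//.
(* Distinct indices give disjoint mirrors, and the mirrors are nonempty, so they cannot coincide. *)
- move=> i j /= ij; apply: contrapT => /eqP nij; have := disj i j nij.
  rewrite -ij setIid; apply/eqP/set0P; case: (I3_cases i) => ->; rewrite ?n0 ?n1 ?n2;
  by [exact: vert_mirror_neq0|exact: unit3_mirror_neq0].
- move=> i j ij; have d := disj i j ij.
  have asym a b : bd_mirror (vert a) `&` bd_mirror (vert b) !=set0.
    by exists <[infty]>%VS; split; exact: bd_vert_infty.
  move: ij d; case: (I3_cases i) => ->; case: (I3_cases j) => -> // _; rewrite ?n0 ?n1 ?n2 => d.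
  + by right.
  + by left; split=> //; exact: bd_vert_unit3_disjoint.
  + by right.
  + by left; split=> //; exact: bd_vert_unit3_disjoint.
  + by left; split=> //; rewrite setIC; exact: bd_vert_unit3_disjoint.
  + by left; split=> //; rewrite setIC; exact: bd_vert_unit3_disjoint.
- have m10 : 0 <= m1 by exact: le_trans m21.
  (* Side [j] joins the two other mirrors, so [m1] belongs to [vert a2] and [m2] to [vert a1]. *)
  move=> j; case: (I3_cases j) => ->.
  + rewrite (_ : 0 - 1 = 2%:R); last exact: val_inj.
    by rewrite add0r n1 n2 e0 geod_distC; exact: geod_dist_vert_unit3.
  + rewrite subrr (_ : 1 + 1 = 2%:R)// n0 n2 e1; exact: geod_dist_vert_unit3.
  + rewrite (_ : 2%:R - 1 = 1); last exact: val_inj.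
    rewrite (_ : 2%:R + 1 = 0); last exact: val_inj.
    by rewrite n0 n1 e2; apply: geod_dist_vert; rewrite eq_sym.
- by rewrite e0 e1 e2; split.
Qed.

Lemma carg_polar (r t : R) : 0 < r -> 0 <= t <= pi -> carg (r%:C%C * expi t) = t.
Proof.
move=> r0 /andP[t0 tpi].
have n : complex.Re `|r%:C%C * expi t| = r.
  rewrite normrM !normc_def /= cos2Dsin2 sqrtr1 expr0n addr0 sqrtr_sqr.
  by rewrite gtr0_norm// mulr1 mulr0 subr0.
rewrite /carg n /= !mul0r subr0 addr0 mulr_ge0 ?(ltW r0) ?sin_ge0_pi ?t0 ?tpi//.
by rewrite mulrAC divff ?gt_eqF// mul1r cosK// in_itv /= t0 tpi.
Qed.

End Configuration.

(** * The parameters *)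

Section PolarVectors.
Context {R : realType}.
Variable x : 'rV[R]_3.

Let r1 := pr1 x.
Let r2 := pr2 x.
Let S1 := ps1 x ^+ 2.
Let S2 := ps2 x ^+ 2.
Let theta := (pi - palpha x) / 2.

Definition polar1 : R[i] := (Num.sqrt 2 * pr2 x)%:C%C * expi (- theta).
Definition polar2 : R[i] := - ((Num.sqrt 2 * pr1 x)%:C%C * expi theta).

Lemma polar_tri j : polar x j = tri polar1 polar2 j.
Proof. by []. Qed.

Let S1E : r1 ^+ 2 = S1 + 1.
Proof. by rewrite /S1 -cosh2_sinh2 subrK. Qed.

Let S2E : r2 ^+ 2 = S2 + 1.
Proof. by rewrite /S2 -cosh2_sinh2 subrK. Qed.

Lemma sqn_expi (r t : R) : sqn (r%:C%C * expi t) = r ^+ 2.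
Proof.
rewrite /sqn /= !mul0r subr0 addr0 !exprMn -mulrDr.
by rewrite cos2Dsin2 mulr1.
Qed.

Lemma sqn_polar1 : sqn polar1 = 2 * r2 ^+ 2.
Proof. by rewrite sqn_expi exprMn sqr_sqrtr. Qed.

Lemma sqn_polar2 : sqn polar2 = 2 * r1 ^+ 2.
Proof.
rewrite -[RHS](_ : sqn ((Num.sqrt 2 * pr1 x)%:C%C * expi theta) = _).
  by rewrite /sqn /polar2 !raddfN /= !sqrrN.
by rewrite sqn_expi exprMn sqr_sqrtr.
Qed.

(** Since [2 theta = pi - alpha], the sign in the second polar vector turns [exp(2 i theta)] into
    [exp(- i alpha)]. *)
Lemma polar_product :
  polar2 * polar1^* = (2 * r1 * r2)%:C%C * (expi (palpha x))^*.
Proof.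
have expi2 : expi theta * (expi (- theta))^* = - (expi (palpha x))^*.
  have -> : expi (palpha x) = (- (cos (theta + theta)) +i* sin (theta + theta))%C.
    have -> : theta + theta = pi - palpha x by rewrite /theta; field.
    by rewrite addrC cosDpi sinDpi cosN sinN !opprK.
  rewrite cosD sinD /expi cosN sinN; apply/eqP; rewrite eq_complex /=.
  by apply/andP; split; apply/eqP; ring.
rewrite /polar1 /polar2 [(_ * expi _)^*]rmorphM /=.
have -> : ((Num.sqrt 2 * pr2 x)%:C%C)^* = (Num.sqrt 2 * pr2 x)%:C%C :> R[i].
  exact: conjc_real.
have -> : (2 * r1 * r2)%:C%C = (Num.sqrt 2 * pr1 x)%:C%C * (Num.sqrt 2 * pr2 x)%:C%C.
  by rewrite -rmorphM; congr (_ %:C)%C; rewrite [RHS]mulrACA -expr2 sqr_sqrtr// mulrA.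
rewrite mulNr mulrACA expi2 mulrN opprK//.
Qed.

Lemma angular_polar : 0 < r1 -> 0 < r2 -> 0 <= palpha x <= pi ->
  angular_invariant (polar x) = palpha x.
Proof.
move=> r1_gt0 r2_gt0 al; rewrite /angular_invariant !polar_tri.
rewrite -[tri _ _ 0]/(vert polar1) -[tri _ _ 1]/(vert polar2) -[tri _ _ 2%:R]/unit3.
rewrite herm_vert -(herm_conj (vert polar2)) !herm_unit3r !col3E !addr0 mulr1.
rewrite (_ : _ * _ = (r1 * r2)%:C%C * expi (palpha x)); first by rewrite carg_polar// mulr_gt0.
rewrite rmorphM /=; set t := (_^-1)%:C%C; have -> : t^* = t by exact: conjc_real.
have tt : t * t = 2^-1 by rewrite -expr2 sqrt2V_sqr.
rewrite mulrACA tt -[polar1 * _]conjCK rmorphM /= conjCK [_^* * _]mulrC polar_product.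
rewrite rmorphM /= conjCK.
have -> : ((2 * r1 * r2)%:C%C)^* = (2 * r1 * r2)%:C%C :> R[i] by exact: conjc_real.
by rewrite mulrA; congr (_ * _); rewrite -mulrA rmorphM rmorph_nat /= mulKf.
Qed.

Hypothesis m21 : pm2 x <= pm1 x.
Hypothesis m2 : 0 < pm2 x.

Lemma ps2_gt0 : 0 < S2.
Proof. by rewrite exprn_gt0// sinh_gt0// divr_gt0. Qed.

Lemma ps12 : S2 <= S1.
Proof.
have s2 : 0 <= ps2 x by apply: sinh_ge0; rewrite divr_ge0// ltW.
have s12 : ps2 x <= ps1 x.
  by rewrite /ps1 /ps2 /sinh ler_pM2r ?invr_gt0// lerB// ler_expR ?lerN2 ler_pM2r.
by rewrite /S1 /S2 ler_pXn2r// nnegrE (le_trans s2).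
Qed.

Lemma coordXE : coordX x = S1 / S2 - 1.
Proof. by rewrite /coordX S1E S2E !addrK. Qed.

Lemma coordYE : coordY x = 1 / S2.
Proof. by rewrite /coordY S2E addrK. Qed.

Lemma coordY_gt0 : 0 < coordY x.
Proof. by rewrite coordYE divr_gt0 ?ps2_gt0. Qed.

Lemma coordX_ge (c : R) : (c <= coordX x) = (c * S2 <= S1 - S2).
Proof.
have S20 := ps2_gt0; rewrite coordXE -(ler_pM2r S20) mulrBl mul1r mulfVK// gt_eqF//.
Qed.

Lemma coordX_le (c : R) : (coordX x <= c) = (S1 - S2 <= c * S2).
Proof.
have S20 := ps2_gt0; rewrite coordXE -(ler_pM2r S20) mulrBl mul1r mulfVK// gt_eqF//.
Qed.

(** This is [s2 ^+ 2] times [Kpoly] at [X = s1 / s2 - 1], [Y = 1 / s2], hence free of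
    denominators. *)
Definition Kpoly_sinh (n : nat) (s1 s2 : R) : R :=
  - n%:R ^+ 2 * ((s1 - s2) ^+ 2 + 1)
  + n%:R * ((s1 - s2) ^+ 2 - 1 + 4 * (1 + s2) * (s1 - s2))
  - 2 * (s1 - s2) * s2 - 4 * s2 - 4 * s2 ^+ 2.

Lemma Kpoly_ge0 n : (0 <= Kpoly n (coordX x) (coordY x)) = (0 <= Kpoly_sinh n S1 S2).
Proof.
have S20 := ps2_gt0; have S20' : S2 != 0 by rewrite gt_eqF.
rewrite -(pmulr_rge0 _ (exprn_gt0 2 S20)); congr (0 <= _).
rewrite coordXE coordYE /Kpoly /Kpoly_sinh; move: (S1) (S2) S20' => s1 s2 s20.
by field.
Qed.

Lemma KsetE n : (0 < n)%N -> Kset R n x <->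
  [/\ 0 <= palpha x <= pi, 2 * S2 <= n%:R * (S1 - S2),
      (n%:R - 1) * (S1 - S2) <= 2 * S2 & 0 <= Kpoly_sinh n S1 S2].
Proof.
move=> n0; have N0 : 0 < n%:R :> R by rewrite ltr0n.
have S20 := ps2_gt0; have S12 := ps12.
have lo : (2 / n%:R <= coordX x) = (2 * S2 <= n%:R * (S1 - S2)).
  by rewrite coordX_ge mulrAC ler_pdivrMr// [n%:R * _]mulrC.
have hi : ((1 < n)%N -> coordX x <= 2 / (n%:R - 1)) <->
    (n%:R - 1) * (S1 - S2) <= 2 * S2.
  have [n1|n1] := ltnP 1 n.
    have N1 : 0 < n%:R - 1 :> R by rewrite subr_gt0 ltr1n.
    by rewrite coordX_le mulrAC ler_pdivlMr// [_ * (n%:R - 1)]mulrC; split=> [->|].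
  have -> : n = 1%N by apply/eqP; rewrite eqn_leq n1.
  by rewrite subrr mul0r; split=> // _; rewrite mulr_ge0// ltW.
rewrite /Kset /= Kpoly_ge0 lo; split=> [[[_ _ _ al] [l /hi h k]]|[al l /hi h k]] //.
by split; split=> //; exact: coordY_gt0.
Qed.

(** The lower bound on [X] forces [S1 > S2], so the two numbers have different moduli whatever the
    angle. *)
Lemma polar_neq n : (0 < n)%N -> 2 * S2 <= n%:R * (S1 - S2) -> polar1 != polar2.
Proof.
move=> n0 lo; apply/eqP => e; have := congr1 sqn e.
rewrite sqn_polar1 sqn_polar2 S1E S2E => h.
have S12 : S1 - S2 = 0 by lra.
by move: lo; rewrite S12 mulr0; have := ps2_gt0; lra.
Qed.

Lemma polar_config n : (0 < n)%N -> 2 * S2 <= n%:R * (S1 - S2) ->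
  triangle_config (sides x) (polar x).
Proof.
move=> n0 lo; have S20 := ps2_gt0; have S12 := ps12.
apply: (@triangle_config_tri _ (pm1 x) (pm2 x) _ _ polar1 polar2) => //.
- exact: polar_neq lo.
- by rewrite m21 ltW.
- by rewrite sqn_polar1 S2E; lra.
- by rewrite sqn_polar2 S1E; lra.
- exact: sqn_polar1.
- exact: sqn_polar2.
Qed.

Let D := sqn (polar2 - polar1) / 2.

Let c := complex.Re (polar2 * polar1^*).

Let sqnB : sqn (polar2 - polar1) = sqn polar1 + sqn polar2 - 2 * c.
Proof.
rewrite /c /sqn; case: polar1 polar2 => [p q] [p' q'] /=; ring.
Qed.

Lemma sqn_center k : sqn (center polar1 polar2 k) =
  2 * (S2 + 1 + k%:~R * (S1 - S2) + (k%:~R ^+ 2 - k%:~R) * D).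
Proof.
have -> : sqn (center polar1 polar2 k) = sqn polar1 +
    2 * k%:~R * (c - sqn polar1) + k%:~R ^+ 2 * sqn (polar2 - polar1).
  rewrite /c /center -[k%:~R](rmorph_int (real_complex R)) /sqn.
  case: polar1 polar2 => [p q] [p' q'] /=; ring.
have -> : c = (sqn polar1 + sqn polar2 - 2 * D) / 2.
  by rewrite /D sqnB; field.
rewrite (_ : sqn (polar2 - polar1) = 2 * D); last by rewrite /D; field.
by rewrite sqn_polar1 sqn_polar2 S1E S2E; field.
Qed.

(** For [k >= 0] every term of [sqn_center] is nonnegative; only negative indices need the
    comparison with [-n]. *)
Lemma polar_far n : (0 < n)%N -> Kset R n x ->
  2 <= sqn (center polar1 polar2 (- n%:Z)) ->
  forall k, 2 <= `|center polar1 polar2 k| ^+ 2.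
Proof.
move=> n0 /(KsetE n0)[_ lo hi _]; rewrite sqn_center => hn k.
have S20 := ps2_gt0; have S12 := ps12.
have D0 : 0 <= D by rewrite divr_ge0// addr_ge0 ?sqr_ge0.
rewrite normCK sqnE -(rmorph_nat (real_complex R)) lecR sqn_center.
have {}hn : 0 <= S2 - n%:R * (S1 - S2) + n%:R * (n%:R + 1) * D.
  move: hn; rewrite (_ : (- n%:Z)%:~R = - n%:R) ?mulrNz//; lra.
suff : 0 <= S2 + k%:~R * (S1 - S2) + (k%:~R ^+ 2 - k%:~R) * D by lra.
case: k => [[|m]|m].
- by rewrite mul0r expr0n subrr mul0r !addr0 ltW.
- rewrite -pmulrn; have m1 : 1 <= m.+1%:R :> R by rewrite ler1n.
  move: (m.+1%:R) m1 => M m1.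
  have h1 : 0 <= M * (S1 - S2) by apply: mulr_ge0; lra.
  have h2 : 0 <= (M ^+ 2 - M) * D by apply: mulr_ge0 => //; nra.
  lra.
have := centers_far n0 (ltn0Sn m) S20 lo hi hn.
rewrite NegzE mulrNz -pmulrn; move: (m.+1%:R) => M; nra.
Qed.

Lemma polar_trans_far n : (0 < n)%N -> Kset R n x ->
  2 <= sqn (center polar1 polar2 (- n%:Z)) ->
  4 <= `|polar2 - polar1| ^+ 4 - (polar2 * polar1^* - polar1 * polar2^*) ^+ 2.
Proof.
move=> n0 /(KsetE n0)[_ lo hi K]; rewrite sqn_center => hn.
have {}hn : 0 <= S2 - n%:R * (S1 - S2) + n%:R * (n%:R + 1) * D.
  move: hn; rewrite (_ : (- n%:Z)%:~R = - n%:R) ?mulrNz//; lra.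
have tr := translation_far n0 ps2_gt0 ps12 K hn.
pose d := complex.Im (polar2 * polar1^*).
have cd : c ^+ 2 + d ^+ 2 = sqn polar1 * sqn polar2.
  by rewrite /c /d /sqn; case: polar1 polar2 => [p q] [p' q'] /=; ring.
have -> : `|polar2 - polar1| ^+ 4 - (polar2 * polar1^* - polar1 * polar2^*) ^+ 2 =
    ((2 * D) ^+ 2 + 4 * d ^+ 2)%:C%C.
  rewrite rmorphD rmorphXn /= (_ : 4 = 2 * 2)%N// exprM normCK sqnE.
  have -> : 2 * D = sqn (polar2 - polar1) by rewrite /D; field.
  congr (_ + _); rewrite /d; case: polar1 polar2 => [p q] [p' q'].
  by apply/eqP; rewrite eq_complex /=; apply/andP; split; apply/eqP; ring.
rewrite -(rmorph_nat (real_complex R)) lecR.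
have cE : c = S1 + S2 + 2 - D.
  by rewrite /D sqnB sqn_polar1 sqn_polar2 S1E S2E; field.
(* After this substitution the squares of [D] cancel, and the claim becomes the linear inequality
   [tr]. *)
have -> : d ^+ 2 = 4 * (S1 + 1) * (S2 + 1) - c ^+ 2.
  by rewrite -S1E -S2E -[d ^+ 2](addKr (c ^+ 2)) cd sqn_polar1 sqn_polar2; ring.
by rewrite cE; nra.
Qed.

End PolarVectors.

(** * Analytic functions *)

Section Entire.
Context {R : realType}.
Implicit Types (u v : R -> R) (c : nat -> R).

Definition entire u := forall a : R, exists c, forall x,
  cvgn (fun N => \sum_(k < N) `|c k * (x - a) ^+ k|) /\
  (fun N => \sum_(k < N) c k * (x - a) ^+ k) @ \oo --> u x.

Lemma entire_affine (p q : R) : entire (fun t => p + q * t).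
Proof.
move=> a; exists (fun k => if k is k'.+1 then if k' is 0 then q else 0 else p + q * a).
move=> x; split.
  apply/cvg_ex; exists (`|p + q * a| + `|q * (x - a)|).
  rewrite -(cvg_shiftn 2); apply: cvg_near_cst; apply: nearW => N.
  rewrite /= addn2 !big_ord_recl /= big1 => [|k _]; last by rewrite mul0r normr0.
  by rewrite expr0 mulr1 expr1 addr0.
rewrite -(cvg_shiftn 2); apply: cvg_near_cst; apply: nearW => N.
rewrite /= addn2 !big_ord_recl /= big1 => [|k _]; last by rewrite mul0r.
by rewrite expr0 mulr1 expr1 addr0; ring.
Qed.

Lemma entire_cst (p : R) : entire (fun=> p).
Proof.
rewrite (_ : (fun=> p) = fun t => p + 0 * t); first exact: entire_affine.
by apply/funext => t; rewrite mul0r addr0.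
Qed.

Lemma entire_expR (l : R) : entire (fun t => expR (l * t)).
Proof.
move=> a; exists (fun k => expR (l * a) * (l ^+ k / k`!%:R)) => x.
have termE k : expR (l * a) * (l ^+ k / k`!%:R) * (x - a) ^+ k =
    expR (l * a) * exp_coeff (l * (x - a)) k.
  by rewrite /exp_coeff /= exprMn; ring.
split.
  rewrite (_ : (fun _ => _) = fun N => expR (l * a) *
    series (exp_coeff `|l * (x - a)|) N).
    by apply: is_cvgM; [exact: is_cvg_cst|exact: is_cvg_series_exp_coeff].
  apply/funext => N; rewrite /series /= big_mkord mulr_sumr.
  apply: eq_bigr => k _; rewrite termE normrM ger0_norm ?expR_ge0//.
  by rewrite /exp_coeff /= normrM normrX [`|_^-1|]ger0_norm// invr_ge0.
rewrite (_ : (fun _ => _) = fun N => expR (l * a) * series (exp_coeff (l * (x - a))) N).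
  have -> : expR (l * x) = expR (l * a) * expR (l * (x - a)).
    by rewrite -expRD; congr expR; ring.
  by apply: cvgM; [exact: cvg_cst|exact: is_cvg_series_exp_coeff].
apply/funext => N; rewrite /series /= big_mkord mulr_sumr.
by apply: eq_bigr => k _; rewrite termE.
Qed.

Lemma cvg_prod (I : Type) (r : seq I) (s : I -> nat -> R) (l : I -> R) :
  (forall i, s i N @[N --> \oo] --> l i) ->
  (\prod_(i <- r) s i N) @[N --> \oo] --> \prod_(i <- r) l i.
Proof.
move=> sl; elim: r => [|i r IHr].
  by rewrite big_nil; under eq_fun do rewrite big_nil; exact: cvg_cst.
rewrite big_cons; under eq_fun do rewrite big_cons.
exact: cvgM.
Qed.

End Entire.

Section Analytic.
Context {R : realType} {d : nat}.
Implicit Types (f g h : 'rV[R]_d -> R).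

Definition analytic f := forall a, analytic_at f a.

Lemma eq_analytic f g : f =1 g -> analytic f -> analytic g.
Proof. by move=> /funext ->. Qed.

(** A partial sum over a box is the product of the one-variable partial sums, so convergence passes
    factor by factor without rearranging any series. *)
Lemma analytic_prod (u : 'I_d -> R -> R) : (forall i, entire (u i)) ->
  analytic (fun x => \prod_i u i (x 0 i)).
Proof.
move=> ue a; have /choice[c cP] := fun i => ue i (a 0 i).
pose C (nu : {ffun 'I_d -> nat}) := \prod_i c i (nu i).
have termE x (N : nat) (nu : {ffun 'I_d -> 'I_N}) :
    monomial_term C a x [ffun i => nat_of_ord (nu i)] =
    \prod_i (c i (nu i) * (x 0 i - a 0 i) ^+ nu i).
  rewrite /monomial_term /C big_split /=; congr (_ * _);
  by apply: eq_bigr => i _; rewrite ffunE.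
exists C; apply: (@filterE _ _ (nbhs_filter a)) => x; split.
  rewrite (_ : (fun _ => _) = fun N =>
      \prod_i \sum_(k < N) `|c i k * (x 0 i - a 0 i) ^+ k|).
    apply/cvg_ex; eexists; apply: cvg_prod => i; exact: (cP i (x 0 i)).1.
  apply/funext => N; rewrite bigA_distr_bigA /=.
  by apply: eq_bigr => nu _; rewrite termE normr_prod.
rewrite (_ : (fun _ => _) = fun N =>
    \prod_i \sum_(k < N) c i k * (x 0 i - a 0 i) ^+ k).
  by apply: cvg_prod => i; exact: (cP i (x 0 i)).2.
apply/funext => N; rewrite bigA_distr_bigA /=.
by apply: eq_bigr => nu _; rewrite termE.
Qed.

Lemma box_sum_nondecreasing (F : {ffun 'I_d -> nat} -> R) : (forall nu, 0 <= F nu) ->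
  {homo (fun N => \sum_(nu : {ffun 'I_d -> 'I_N}) F [ffun i => nat_of_ord (nu i)]) :
    M N / (M <= N)%N >-> M <= N}.
Proof.
move=> F0 M N MN.
pose w (nu : {ffun 'I_d -> 'I_M}) : {ffun 'I_d -> 'I_N} := [ffun i => widen_ord MN (nu i)].
have w_inj : injective w.
  move=> nu mu e; apply/ffunP => i; apply: val_inj.
  by have := congr1 (fun h : {ffun _} => nat_of_ord (h i)) e; rewrite !ffunE.
rewrite [leRHS](bigID (mem (w @: [set: {ffun 'I_d -> 'I_M}])%SET)) /=.
rewrite big_imset /=; last by move=> ? ? _ _; exact: w_inj.
rewrite -[leLHS]addr0 lerD ?sumr_ge0// le_eqVlt; apply/orP; left; apply/eqP.
apply: eq_big => [nu|nu _]; first by rewrite inE.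
by congr F; apply/ffunP => i; rewrite !ffunE.
Qed.

Lemma analytic_comb (p q : R) f g : analytic f -> analytic g ->
  analytic (fun x => p * f x + q * g x).
Proof.
move=> af ag a; have [c cP] := af a; have [c' c'P] := ag a.
exists (fun nu => p * c nu + q * c' nu).
have termE x nu : monomial_term (fun nu => p * c nu + q * c' nu) a x nu =
    p * monomial_term c a x nu + q * monomial_term c' a x nu.
  by rewrite /monomial_term; ring.
apply: (@filterS2 _ _ (nbhs_filter a) _ _ _ _ cP c'P) => x [cv cl] [cv' cl'].
split; last first.
  rewrite (_ : (fun _ => _) = fun N =>
     p * \sum_(nu : {ffun 'I_d -> 'I_N}) monomial_term c a x [ffun i => nat_of_ord (nu i)] +
     q * \sum_(nu : {ffun 'I_d -> 'I_N}) monomial_term c' a x [ffun i => nat_of_ord (nu i)]).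
    by apply: cvgD; apply: cvgM => //; exact: cvg_cst.
  apply/funext => N; rewrite !mulr_sumr -big_split /=.
  by apply: eq_bigr => nu _; rewrite termE.
pose B := `|p| * limn (fun N => \sum_(nu : {ffun 'I_d -> 'I_N})
            `|monomial_term c a x [ffun i => nat_of_ord (nu i)]|) +
          `|q| * limn (fun N => \sum_(nu : {ffun 'I_d -> 'I_N})
            `|monomial_term c' a x [ffun i => nat_of_ord (nu i)]|).
apply: nondecreasing_is_cvgn.
  by apply: (@box_sum_nondecreasing (fun nu => `|monomial_term _ a x nu|)) => nu.
exists B => _ [N _ <-].
apply: (@le_trans _ _ (`|p| * \sum_(nu : {ffun 'I_d -> 'I_N})
            `|monomial_term c a x [ffun i => nat_of_ord (nu i)]| +
          `|q| * \sum_(nu : {ffun 'I_d -> 'I_N})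
            `|monomial_term c' a x [ffun i => nat_of_ord (nu i)]|)).
  rewrite !mulr_sumr -big_split /=; apply: ler_sum => nu _.
  by rewrite termE (le_trans (ler_normD _ _))// !normrM.
rewrite lerD// ler_wpM2l//.
  apply: (nondecreasing_cvgn_le _ cv).
  by apply: (@box_sum_nondecreasing (fun nu => `|monomial_term _ a x nu|)).
apply: (nondecreasing_cvgn_le _ cv').
by apply: (@box_sum_nondecreasing (fun nu => `|monomial_term _ a x nu|)).
Qed.

Lemma analytic_cst (p : R) : analytic (fun=> p).
Proof.
have one : analytic (fun x : 'rV[R]_d => \prod_(i < d) 1).
  by apply: (@analytic_prod (fun _ _ => 1)) => _; exact: entire_cst.
apply: eq_analytic (analytic_comb p 0 one one) => x.
by rewrite big1// mulr1 mul0r addr0.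
Qed.

Lemma analyticD f g : analytic f -> analytic g -> analytic (fun x => f x + g x).
Proof.
by move=> af ag; apply: eq_analytic (analytic_comb 1 1 af ag) => x; rewrite !mul1r.
Qed.

Lemma analyticZ (p : R) f : analytic f -> analytic (fun x => p * f x).
Proof.
by move=> af; apply: eq_analytic (analytic_comb p 0 af af) => x; rewrite mul0r addr0.
Qed.

Lemma analyticB f g : analytic f -> analytic g -> analytic (fun x => f x - g x).
Proof.
by move=> af ag; apply: eq_analytic (analytic_comb 1 (-1) af ag) => x; rewrite mul1r mulN1r.
Qed.

Lemma entire_analytic (i : 'I_d) (u : R -> R) : entire u -> analytic (fun x => u (x 0 i)).
Proof.
move=> ue; have := @analytic_prod (fun j => if j == i then u else fun=> 1) _.
have -> : (fun x : 'rV[R]_d => \prod_j (if j == i then u else fun=> 1) (x 0 j)) =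
    fun x => u (x 0 i).
  apply/funext => x; rewrite (bigD1 i)//= eqxx big1 ?mulr1// => j ji.
  by rewrite (negbTE ji).
by apply=> j; case: ifP => // _; exact: entire_cst.
Qed.

Lemma entire_analytic2 (i j : 'I_d) (u v : R -> R) : i != j -> entire u -> entire v ->
  analytic (fun x => u (x 0 i) * v (x 0 j)).
Proof.
move=> ij ue ve.
have := @analytic_prod (fun k => if k == i then u else if k == j then v else fun=> 1) _.
have -> : (fun x : 'rV[R]_d =>
    \prod_k (if k == i then u else if k == j then v else fun=> 1) (x 0 k)) =
    fun x => u (x 0 i) * v (x 0 j).
  apply/funext => x; rewrite (bigD1 i)//= eqxx (bigD1 j)/=; last by rewrite eq_sym.
  rewrite eqxx eq_sym (negbTE ij) big1 ?mulr1// => k /andP[ki kj].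
  by rewrite (negbTE ki) (negbTE kj).
by apply=> k; do 2![case: ifP => // _]; exact: entire_cst.
Qed.

Definition globally_semi_analytic (A : set 'rV[R]_d) : Prop :=
  exists (I J : finType) (f g : I -> J -> 'rV[R]_d -> R),
    (forall i j, analytic (f i j) /\ analytic (g i j)) /\
    A = [set x | exists i, forall j, f i j x = 0 /\ 0 < g i j x].

Lemma globally_semi_analyticW A : globally_semi_analytic A -> semi_analytic A.
Proof.
move=> [I [J [f [g [an ->]]]]] a; exists setT; split => //; first exact: openT.
exists #|I|, #|J|, (fun i j => f (enum_val i) (enum_val j)),
  (fun i j => g (enum_val i) (enum_val j)); split.
  by move=> i j x _; have [? ?] := an (enum_val i) (enum_val j).
rewrite setIT setTI; apply/seteqP; split=> x /= [i h].
  by exists (enum_rank i) => j; rewrite enum_rankK.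
by exists (enum_val i) => j; have := h (enum_rank j); rewrite enum_rankK.
Qed.

Lemma globally_semi_analyticI A B : globally_semi_analytic A ->
  globally_semi_analytic B -> globally_semi_analytic (A `&` B).
Proof.
move=> [I [J [f [g [an ->]]]]] [I' [J' [f' [g' [an' ->]]]]].
exists (I * I')%type, (J + J')%type.
exists (fun i j => match j with inl j => f i.1 j | inr j => f' i.2 j end).
exists (fun i j => match j with inl j => g i.1 j | inr j => g' i.2 j end).
split; first by move=> i [] j.
apply/seteqP; split=> x /= => [[[i h] [i' h']]|[[i i'] h]].
  by exists (i, i') => -[] j.
by split; [exists i => j; exact: (h (inl j))|exists i' => j; exact: (h (inr j))].
Qed.

Lemma globally_semi_analytic_gt0 g : analytic g ->
  globally_semi_analytic [set x | 0 < g x].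
Proof.
move=> ag; exists unit, unit, (fun _ _ => fun=> 0), (fun _ _ => g); split.
  by move=> _ _; split=> //; exact: analytic_cst.
by apply/seteqP; split=> x /= => [h|[_ /(_ tt)[]]] //; exists tt.
Qed.

(** The set is the union of [g = 0] and [g > 0]; the slot left free in each alternative is filled by
    [1 > 0] or by [0 = 0]. *)
Lemma globally_semi_analytic_ge0 g : analytic g ->
  globally_semi_analytic [set x | 0 <= g x].
Proof.
move=> ag; exists bool, unit, (fun b _ => if b then g else fun=> 0),
  (fun b _ => if b then fun=> 1 else g); split.
  by move=> [] _; split=> //; exact: analytic_cst.
apply/seteqP; split=> x /=.
  by rewrite le_eqVlt => /orP[/eqP e|h]; [exists true|exists false].
by move=> [[] /(_ tt)[e h]]; [rewrite e|exact: ltW].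
Qed.

End Analytic.

(** * The sets K_n are semi-analytic *)

Section KsetSemiAnalytic.
Context {R : realType}.

Lemma entire_comb (p q : R) u v : entire u -> entire v ->
  entire (fun t => p * u t + q * v t).
Proof.
move=> ue ve a; have [c cP] := ue a; have [c' c'P] := ve a.
exists (fun k => p * c k + q * c' k) => x.
have [cv cl] := cP x; have [cv' cl'] := c'P x.
have termE k : (p * c k + q * c' k) * (x - a) ^+ k =
    p * (c k * (x - a) ^+ k) + q * (c' k * (x - a) ^+ k) by ring.
have mono (c0 : nat -> R) :
    {homo (fun N => \sum_(k < N) `|c0 k * (x - a) ^+ k|) : M N / (M <= N)%N >-> M <= N}.
  by apply/nondecreasing_seqP => N; rewrite big_ord_recr /= lerDl.
split; last first.
  rewrite (_ : (fun _ => _) = fun N => p * \sum_(k < N) c k * (x - a) ^+ k +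
     q * \sum_(k < N) c' k * (x - a) ^+ k).
    by apply: cvgD; apply: cvgM => //; exact: cvg_cst.
  by apply/funext => N; rewrite !mulr_sumr -big_split /=; apply: eq_bigr.
apply: nondecreasing_is_cvgn; first exact: (mono (fun k => p * c k + q * c' k)).
exists (`|p| * limn (fun N => \sum_(k < N) `|c k * (x - a) ^+ k|) +
        `|q| * limn (fun N => \sum_(k < N) `|c' k * (x - a) ^+ k|)) => _ [N _ <-].
apply: (@le_trans _ _ (`|p| * \sum_(k < N) `|c k * (x - a) ^+ k| +
                       `|q| * \sum_(k < N) `|c' k * (x - a) ^+ k|)).
  rewrite !mulr_sumr -big_split /=; apply: ler_sum => k _.
  by rewrite termE (le_trans (ler_normD _ _))// !normrM.
by rewrite lerD// ler_wpM2l//; [exact: (nondecreasing_cvgn_le (mono c) cv)|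
  exact: (nondecreasing_cvgn_le (mono c') cv')].
Qed.

Lemma entire_sinh2 : entire (fun t : R => sinh (t / 2) ^+ 2).
Proof.
rewrite (_ : (fun _ => _) = fun t : R =>
    4^-1 * (1 * expR (1 * t) + 1 * expR (-1 * t)) + 1 * (- 2^-1)).
  apply: entire_comb; last exact: entire_cst.
  by apply: entire_comb; exact: entire_expR.
apply/funext => t; have := expRxMexpNx_1 (t / 2).
have -> : 1 * t = t / 2 + t / 2 by field.
have -> : -1 * t = - (t / 2) + - (t / 2) by field.
rewrite /sinh !expRD; move: (expR (t / 2)) (expR (- (t / 2))) => a b ab.
have -> : ((a - b) / 2) ^+ 2 = 4^-1 * (1 * (a * a) + 1 * (b * b)) - 2^-1 * (a * b) by field.
by rewrite ab; ring.
Qed.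

(** Products are formed only across distinct variables, so a power in one variable is linearized
    into exponentials: [sinh(t/2)^4 = sinh(t)^2 / 4 - sinh(t/2)^2]. *)
Lemma entire_sinh4 : entire (fun t : R => (sinh (t / 2) ^+ 2) ^+ 2).
Proof.
rewrite (_ : (fun _ => _) = fun t : R => 4^-1 *
    (4^-1 * (1 * expR (2 * t) + 1 * expR (-2 * t)) + 1 * (- 2^-1)) +
    (-1) * (sinh (t / 2) ^+ 2)).
  apply: entire_comb; last exact: entire_sinh2.
  apply: entire_comb; last exact: entire_cst.
  by apply: entire_comb; exact: entire_expR.
apply/funext => t; have := expRxMexpNx_1 (t / 2).
have -> : 2 * t = t / 2 + t / 2 + (t / 2 + t / 2) by field.
have -> : -2 * t = - (t / 2) + - (t / 2) + (- (t / 2) + - (t / 2)) by field.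
rewrite /sinh !expRD; move: (expR (t / 2)) (expR (- (t / 2))) => a b ab.
have b2 : (a * b) ^+ 2 = 1 by rewrite ab expr1n.
have -> : (((a - b) / 2) ^+ 2) ^+ 2 = 4^-1 * (4^-1 * (1 * (a * a * (a * a)) +
   1 * (b * b * (b * b))) + 1 * (- 2^-1)) + -1 * ((a - b) / 2) ^+ 2 +
   (1 - (a * b) ^+ 2) / 8 + (1 - a * b) * ((a - b) / 2) ^+ 2.
  by field.
by rewrite b2 ab; ring.
Qed.

Let s1 (x : 'rV[R]_3) : R := ps1 x ^+ 2.
Let s2 (x : 'rV[R]_3) : R := ps2 x ^+ 2.

Let analytic_s1 : analytic s1.
Proof. exact: (entire_analytic 0 entire_sinh2). Qed.

Let analytic_s2 : analytic s2.
Proof. exact: (entire_analytic 1 entire_sinh2). Qed.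

(** Expanded into monomials, the polynomial needs only the two squares, the mixed product [s1 * s2]
    and linear terms, each covered by the separated-variable lemmas. *)
Lemma analytic_Kpoly_sinh (n : nat) : analytic (fun x => Kpoly_sinh n (s1 x) (s2 x)).
Proof.
have s11 : analytic (fun x => s1 x ^+ 2) := entire_analytic 0 entire_sinh4.
have s22 : analytic (fun x => s2 x ^+ 2) := entire_analytic 1 entire_sinh4.
have s12 : analytic (fun x => s1 x * s2 x).
  exact: (@entire_analytic2 R 3 0 1 _ _ isT entire_sinh2 entire_sinh2).
pose N : R := n%:R.
apply: (@eq_analytic _ _ (fun x => (N - N ^+ 2) * s1 x ^+ 2 +
  ((- N ^+ 2 - 3 * N - 2) * s2 x ^+ 2 + ((2 * N ^+ 2 + 2 * N - 2) * (s1 x * s2 x) +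
   (4 * N * s1 x + ((- 4 * N - 4) * s2 x + (- N ^+ 2 - N))))))).
  by move=> x; rewrite /Kpoly_sinh -/N; ring.
apply: (analyticD (analyticZ _ s11)); apply: (analyticD (analyticZ _ s22)).
apply: (analyticD (analyticZ _ s12)); apply: (analyticD (analyticZ _ analytic_s1)).
exact: (analyticD (analyticZ _ analytic_s2) (analytic_cst _)).
Qed.

Lemma Kset_semi_analytic (n : nat) : (0 < n)%N -> semi_analytic (Kset R n).
Proof.
move=> n0; apply: globally_semi_analyticW.
have coord i : analytic (fun x : 'rV[R]_3 => x 0 i).
  have idE : entire (fun t : R => t).
    rewrite (_ : (fun t => t) = fun t => 0 + 1 * t); first exact: entire_affine.
    by apply/funext => t; ring.
  exact: (entire_analytic i idE).
have -> : Kset R n = [set x | 0 < pm2 x] `&` ([set x | 0 <= pm1 x - pm2 x] `&`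
  ([set x | 0 <= palpha x] `&` ([set x | 0 <= pi - palpha x] `&`
  ([set x | 0 <= n%:R * (s1 x - s2 x) - 2 * s2 x] `&`
  ([set x | 0 <= 2 * s2 x - (n%:R - 1) * (s1 x - s2 x)] `&`
   [set x | 0 <= Kpoly_sinh n (s1 x) (s2 x)]))))).
  apply/seteqP; split=> x; rewrite /setI /= !subr_ge0.
    move=> kx; have [[m21 m2 _ /andP[al al']] _] := kx.
    have /(KsetE m21 m2 n0)[_ lo hi k] := kx.
    by do !split=> //; move: k; rewrite /Kpoly_sinh subr_ge0.
  move=> [m2 [m21 [al [al' [lo [hi k]]]]]]; apply/(KsetE m21 m2 n0).
  by split=> //; rewrite ?al// /Kpoly_sinh subr_ge0.
apply: globally_semi_analyticI; first exact/globally_semi_analytic_gt0/coord.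
do !apply: globally_semi_analyticI; apply: globally_semi_analytic_ge0.
- by apply: analyticB; exact: coord.
- exact: coord.
- by apply: analyticB; [exact: analytic_cst|exact: coord].
- by apply: analyticB; apply: analyticZ => //; exact: analyticB.
- by apply: analyticB; apply: analyticZ => //; exact: analyticB.
- exact: analytic_Kpoly_sinh.
Qed.

End KsetSemiAnalytic.

Lemma creflection_involution (R : realType) (n : C3 R) : herm n n != 0 ->
  (creflection n * creflection n)%g = 1%g.
Proof.
move=> n0; rewrite [LHS]PU21_piM; congr (\pi_(PU21 R) _); apply: val_inj => /=.
apply/matrixP => i k; have := reflK n0 (delta_mx k 0).
rewrite -!refl_mxE mulmxA => /(congr1 (fun z : C3 R => z i 0)).
by rewrite -colE !mxE eqxx andbT.
Qed.

Theorem theorem1p2 (R : realType) :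
  (forall n : nat, (0 < n)%N -> semi_analytic (Kset R n))
  /\
  (forall (n : nat) (x : 'rV[R]_3), (0 < n)%N -> Kset R n x ->
     exists phi : {multiplicative Gamma -> PU21 R},
       triangle_rep (sides x) (polar x) phi
       /\ angular_invariant (polar x) = palpha x)
  /\
  (forall (n : nat) (x : 'rV[R]_3), (0 < n)%N ->
     0 < pm2 x -> pm2 x <= pm1 x ->
     let r1 := cosh (pm1 x / 2) in let r2 := cosh (pm2 x / 2) in
     let s1 := sinh (pm1 x / 2) in let s2 := sinh (pm2 x / 2) in
     exists X Y : R,
       [/\ X = (r1 ^+ 2 - 1) / (r2 ^+ 2 - 1) - 1,
           X = s1 ^+ 2 / s2 ^+ 2 - 1,
           Y = 1 / (r2 ^+ 2 - 1),
           Y = 1 / s2 ^+ 2 &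
           Kset R n x <->
             [/\ 0 < Y,
                 0 <= palpha x <= pi,
                 X >= 2 / n%:R,
                 (n <> 1%N) -> X <= 2 / (n%:R - 1) &
                 - n%:R ^+ 2 * (X ^+ 2 + Y ^+ 2)
                 + n%:R * (X ^+ 2 - Y ^+ 2 + 4 * (Y + 1) * X)
                 - 2 * X - 4 * Y - 4 >= 0]])
  /\
  (forall (n : nat) (x : 'rV[R]_3) (phi : {multiplicative Gamma -> PU21 R}),
     (0 < n)%N -> Kset R n x ->
     let R1 := creflection (polar x 0) in
     let R2 := creflection (polar x 1) in
     let R3 := creflection (polar x 2%:R) in
     phi (gen 0) = R1 -> phi (gen 1) = R2 -> phi (gen 2%:R) = R3 ->
     (discrete_rep phi /\ faithful_rep phi <->
      ~ elliptic (R1 * (R2 * R1) ^+ n * R3)%g)).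
Proof.
split; first exact: Kset_semi_analytic.
split; [|split].
- move=> n x n0 kx; have [[m21 m2 _ al] _] := kx.
  have /(KsetE m21 m2 n0)[_ lo _ _] := kx.
  have cfg := polar_config m21 m2 n0 lo.
  have [phi phiE] : exists phi : {multiplicative Gamma -> PU21 R},
      forall j, phi (gen j) = creflection (polar x j).
    apply: Gamma_lift => j; apply: creflection_involution.
    by rewrite gt_eqF//; case: cfg.
  exists phi; split; first by split.
  by apply: angular_polar => //; exact: cosh_gt0.
- move=> n x n0 m2 m21; exists (coordX x), (coordY x); split.
  + by [].
  + exact: coordXE.
  + by [].
  + exact: coordYE.
  rewrite /Kset /=; split=> [[[_ _ Y0 al] [lo hi k]]|[Y0 al lo hi k]].
    split=> // n1; apply: hi; rewrite ltn_neqAle n0 andbT eq_sym.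
    exact/eqP.
  split; split=> // n1; apply: hi => e.
  by rewrite e in n1.
move=> n x phi n0 kx R1 R2 R3 e0 e1 e2; have [[m21 m2 _ _] _] := kx.
have phiE j : phi (gen j) = creflection (tri (polar1 x) (polar2 x) j).
  by rewrite -polar_tri; case: (I3_cases j) => ->.
have test : phi (test_word n) = (R1 * (R2 * R1) ^+ n * R3)%g.
  rewrite /test_word !gmulfM e0 e2; congr (_ * _ * _)%g.
  elim: n {n0 kx} => [|n IHn]; first by rewrite !expg0 phi1.
  by rewrite !expgS gmulfM IHn gmulfM e0 e1.
rewrite -test; split.
  by move=> df el; exact: (elliptic_not_discrete_faithful phiE el df).
move=> nel; have far : 2 <= sqn (center (polar1 x) (polar2 x) (- n%:Z)).
  by rewrite leNgt; apply/negP => lt2; apply: nel; apply/(test_word_elliptic phiE).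
have far_all := polar_far m21 m2 n0 kx far.
have tfar := polar_trans_far m21 m2 n0 kx far.
by split; [exact: discrete_of_far tfar|exact: faithful_of_far tfar].
Qed.
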